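(* Let $p,q<0$ be such that $q\leq p<0$, and let $p'$ be defined by $\frac1p+\frac1{p'}=1$. Let $\mathbb{X}$ be a metric measure space with a polar decomposition at $a\in\mathbb{X}$. Suppose that $u,v\geq 0$ are locally integrable functions on $\mathbb{X}$. Then the inequality $$\left[\int_{\mathbb{X}}\left(\int_{\mathbb{X}\setminus B(a,|x|_{a})}f(y)\,dy\right)^{q}u(x)\,dx\right]^{\frac1q}\geq C_{2}(p,q)\left(\int_{\mathbb{X}}f^{p}(x)v(x)\,dx\right)^{\frac1p}$$ holds, with some constant $C_2(p,q)>0$, for all non-negative real-valued measurable functions $f$ on $\mathbb{X}$ if and only if $$0<D_{2}:=\inf_{x\neq a}\mathcal{D}_{2}(|x|_{a}),\qquad \mathcal{D}_{2}(|x|_{a}):=\left(\int_{\mathbb{X}\setminus B(a,|x|_{a})}u(y)\,dy\right)^{\frac1q}\left(\int_{\mathbb{X}\setminus B(a,|x|_{a})}v^{1-p'}(y)\,dy\right)^{\frac1{p'}},$$ and $\mathcal{D}_{2}(|x|_{a})$ is non-increasing (as a function of $|x|_a$). Moreover, the largest constant $C_{2}(p,q)$ in the inequality satisfies $$D_{2}\geq C_{2}(p,q)\geq |p|^{\frac1q}(p')^{\frac1{p'}}D_{2}.$$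
   Context: $\mathbb{X}$ is a metric space with metric $d$, equipped with a Borel measure $dx$. It has a polar decomposition at $a\in\mathbb{X}$ if there is a locally integrable function $\lambda\in L^1_{loc}$ such that for all $f\in L^1(\mathbb{X})$ $$\int_{\mathbb{X}}f(x)\,dx=\int_0^\infty\int_{\Sigma_r}f(r,\omega)\lambda(r,\omega)\,d\omega_r\,dr,$$ where $\Sigma_r=\{x\in\mathbb{X}:d(x,a)=r\}\subset\mathbb{X}$ carries a measure denoted $d\omega_r$, points are written $x=(r,\omega)$ with $r=d(x,a)$ and $\omega\in\Sigma_r$, and $(r,\omega)\to a$ as $r\to0$. Notation: $B(a,r)=\{x\in\mathbb{X}:d(x,a)<r\}$ and $|x|_a:=d(a,x)$. For $p<0$ one has $p'=\frac{p}{p-1}\in(0,1)$. Powers with negative exponent $r<0$ are taken in $[0,+\infty]$, with $0^{r}=+\infty$ and $(+\infty)^{r}=0$.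
   Formalization: That the inequality forces D_2(|x|_a) to be non-increasing is false and dropped; monotonicity is assumed for sufficiency and for the lower bound on C_2. In D_2(|x|_a) the product 0·∞ is read as +∞; locally integrable means integrable on balls. *)

(* Defs.v *)
From HB Require Import structures.
From mathcomp Require Import all_boot all_order all_algebra.
From mathcomp Require Import all_classical all_reals all_analysis.

Set Implicit Arguments.
Unset Strict Implicit.
Unset Printing Implicit Defensive.

Import Order.TTheory GRing.Theory Num.Theory.
Import numFieldNormedType.Exports.

Local Open Scope classical_set_scope.
Local Open Scope ring_scope.

(* The [Measurable] structure is pointed; this is no restriction for a metric
   space with a distinguished point [a]. *)
HB.mixin Record isBorelMetric (d : measure_display) (R : realType) T
    & Metric R T & Measurable d T := {
  borelE : (measurable : set (set T)) = <<s open >>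
}.

#[short(type="borelMetricType")]
HB.structure Definition BorelMetric (d : measure_display) (R : realType) :=
  { T of Metric R T & Measurable d T & isBorelMetric d R T }.

Section Definitions.
Context {d : measure_display} {R : realType} {X : borelMetricType d R}.
Implicit Types (mu : {measure set X -> \bar R}) (a : X) (f u v w : X -> R).

(* Local integrability means integrability on bounded sets; in a proper metric
   space this is the same as integrability on compact sets. *)
Definition loc_integrable mu w :=
  measurable_fun setT w /\
  forall (x : X) (r : R), mu.-integrable (ball x r) (EFin \o w).

Definition msphere a (r : R) : set X := [set x | mdist x a = r].

(* [sigma r] is the measure d omega_r; it is represented as a Borel measure on
   the whole space, but only its restriction to the sphere is ever used.  The
   polar coordinates (r, omega) of x are r = mdist x a and omega = x, so that
   (r, omega) --> a as r --> 0 holds by definition. *)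
Definition polar_decomposition mu a :=
  exists (lambda : X -> R) (sigma : R -> {measure set X -> \bar R}),
    loc_integrable mu lambda /\
    forall f, mu.-integrable setT (EFin \o f) ->
      (\int[mu]_x (f x)%:E =
       \int[lebesgue_measure]_(r in `]0%R, +oo[)
         \int[sigma r]_(x in msphere a r) (f x * lambda x)%:E)%E.

(* Powers of elements of [0, +oo]: for r < 0, 0 ^ r = +oo and (+oo) ^ r = 0,
   whereas the library has 0 `^ r = 0 and +oo `^ r = +oo. *)
Definition epow (x : \bar R) (r : R) : \bar R :=
  (if (r < 0)%R then (x `^ (- r))^-1 else x `^ r)%E.

(* Product on [0, +oo] with 0 * +oo = +oo.  This is the value of the
   indeterminate form for which C <= x * y holds, x = U ^ (1 / q) with q < 0,
   exactly when C * U ^ (- 1 / q) <= y, for all real C > 0.  The usual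
   convention 0 * +oo = 0 is not suitable for the characteristic function D2:
   if u = v = 1 on the real line then D2 is the form 0 * +oo at every radius,
   and the Hardy inequality holds for every C. *)
Definition upper_mule (x y : \bar R) : \bar R :=
  (if ((x == 0) && (y == +oo)) || ((x == +oo) && (y == 0)) then +oo
   else x * y)%E.

(* Inside the integrals against u and v the usual convention 0 * +oo = 0 is
   used, that is, one integrates against the measures u dx and v dx. *)
Definition hardy_inequality mu a (p q : R) u v (C : R) :=
  forall f, measurable_fun setT f -> (forall x, 0 <= f x) ->
    (C%:E * epow (\int[mu]_x (epow (f x)%:E p * (v x)%:E)) p^-1 <=
     epow (\int[mu]_x
       (epow (\int[mu]_(y in ~` ball a (mdist a x)) (f y)%:E) q * (u x)%:E))
       q^-1)%E.

Definition hardy_holds mu a (p q : R) u v :=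
  exists2 C : R, 0 < C & hardy_inequality mu a p q u v C.

(* +oo if every C > 0 is admissible. *)
Definition hardy_best_constant mu a (p q : R) u v : \bar R :=
  ereal_sup [set C%:E | C in
    [set C : R | 0 < C /\ hardy_inequality mu a p q u v C]].

Definition hardy_char mu a (q p' : R) u v (r : R) : \bar R :=
  upper_mule (epow (\int[mu]_(y in ~` ball a r) (u y)%:E)%E q^-1)
    (epow (\int[mu]_(y in ~` ball a r) (v y `^ (1 - p'))%:E)%E p'^-1).

Definition hardy_char_inf mu a (q p' : R) u v : \bar R :=
  ereal_inf [set hardy_char mu a q p' u v (mdist a x) | x in [set x | x != a]].

Definition hardy_char_nonincreasing mu a (q p' : R) u v :=
  forall x y : X, x != a -> y != a -> mdist a x <= mdist a y ->
    (hardy_char mu a q p' u v (mdist a y) <=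
     hardy_char mu a q p' u v (mdist a x))%E.

End Definitions.

(* Main.v *)
(* Write [N r] for the complement of the ball B(a,r), [U r] and [W r] for the
   integrals of [u] and [v^(1-p')] over [N r], and [D = U^(1/q) W^(1/p')].

   Necessity: test the inequality with [v^(1-p')] on [N r] and a constant on
   the ball, and let the constant tend to infinity; as [p < 0] the ball then
   contributes nothing to the right-hand side.

   Sufficiency: let [0 < C <= D].  By the reverse Hoelder inequality with the
   weight [U^(-1/q)], the monotonicity of [D], and
     [\int_(N r) W^(-1/p) v^(1-p') >= p' W(r)^(1/p')],
   one gets, for [F x] the integral of [f] over [N |x|],
     [F(x)^q <= p'^(q/p') C^q U(x)^(-1/p') K(x)^(q/p)],
   where [K(x)] is the integral of [f^p v U^(-1/q)] over [N |x|].  Jensen's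
   inequality for the measure [f^p v dx] replaces [K^(q/p)] by
   [A^(q/p-1) \int_(N |x|) f^p v U^(-1/p)], with [A = \int f^p v].  Now integrate
   against [u dx], exchange the integrals, and use
     [\int_(|x| <= r) U^(-1/p') u <= |p| U(r)^(1/p)].
   This bound on a power of the tail of [u dx] needs spheres to be [u dx]-null,
   the only consequence of the polar decomposition that is used. *)
Require Import Defs.
From HB Require Import structures.
From mathcomp Require Import all_boot all_order all_algebra.
From mathcomp Require Import all_classical all_reals all_analysis.
From mathcomp Require Import measurable_realfun ring lra.

Set Implicit Arguments.
Unset Strict Implicit.
Unset Printing Implicit Defensive.

Import Order.TTheory GRing.Theory Num.Theory.
Import numFieldNormedType.Exports.

Local Open Scope classical_set_scope.
Local Open Scope ring_scope.

Lemma measurable_fun_powR d (T : measurableType d) (R : realType)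
    (D : set T) (f : T -> R) (r : R) :
  measurable_fun D f -> measurable_fun D (fun x => f x `^ r).
Proof. by move=> mf; have := measurableT_comp (measurable_powR r) mf. Qed.

(** * Densities, Fubini-Tonelli and the layer cake formula *)

Section density.
Context d (T : measurableType d) (R : realType) (mu : {measure set T -> \bar R}).
Variable w : T -> R.
Hypothesis mw : measurable_fun setT w.
Hypothesis w0 : forall x, 0 <= w x.

(** The proofs of measurability and nonnegativity are arguments so that the measure structure built
    from them can be inferred from the term itself. *)
Definition density (_ : measurable_fun setT w) (_ : forall x, 0 <= w x)
  (A : set T) : \bar R := (\int[mu]_(x in A) (w x)%:E)%E.

Local Notation nu := (density mw w0).

Let density0 : nu set0 = 0%E. Proof. by rewrite /density integral_set0. Qed.

Let density_ge0 A : (0 <= nu A)%E.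
Proof. by apply: integral_ge0 => x _; rewrite lee_fin. Qed.

Let density_sigma_additive : semi_sigma_additive nu.
Proof.
apply: semi_sigma_additive_nng_induced; first exact/measurable_EFinP.
by move=> x; rewrite lee_fin.
Qed.

HB.instance Definition _ := isMeasure.Build d T R nu density0 density_ge0
  density_sigma_additive.

End density.

Section integral_density.
Context d (T : measurableType d) (R : realType) (mu : {measure set T -> \bar R}).
Variable w : T -> R.
Hypothesis mw : measurable_fun setT w.
Hypothesis w0 : forall x, 0 <= w x.
Local Notation nu := (density mu mw w0).
Local Open Scope ereal_scope.
Import HBNNSimple.

Let mwE : measurable_fun setT (EFin \o w). Proof. exact/measurable_EFinP. Qed.

Let integral_density_nnsfun (f : {nnsfun T >-> R}) :
  \int[nu]_x (f x)%:E = \int[mu]_x ((f x)%:E * (w x)%:E).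
Proof.
under [LHS]eq_integral => x _ do rewrite fimfunE -fsumEFin//.
rewrite [LHS]ge0_integral_fsum//; last 2 first.
  - by move=> r; exact/measurable_EFinP/measurableT_comp.
  - by move=> n x _; rewrite EFinM nnfun_muleindic_ge0.
under [RHS]eq_integral => x _.
  rewrite fimfunE -fsumEFin// ge0_mule_fsuml; last first.
    by move=> r; rewrite EFinM nnfun_muleindic_ge0.
  over.
rewrite [RHS]ge0_integral_fsum//; last 2 first.
  - move=> r; apply: emeasurable_funM => //.
    exact/measurable_EFinP/measurableT_comp.
  - move=> n x _; rewrite mule_ge0 ?lee_fin//.
    by rewrite -lee_fin EFinM nnfun_muleindic_ge0.
apply: eq_fsbigr => r _.
rewrite integralZl_indic_nnsfun//.
under [RHS]eq_integral do rewrite EFinM -muleA.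
have [r0|r0] := ltP r 0%R.
  rewrite preimage_nnfun0// integral0_eq ?mule0; last first.
    by move=> x _; rewrite indicE in_set0.
  by rewrite integral0_eq// => x _; rewrite indicE in_set0 mul0e mule0.
have mfr : measurable (f @^-1` [set r]) by exact: measurable_sfunP.
rewrite ge0_integralZl//; last 2 first.
- by apply: emeasurable_funM => //; exact/measurable_EFinP.
- by move=> x _; rewrite mule_ge0 ?lee_fin.
congr (_ * _); rewrite integral_indic// setIT /= /density [LHS]integral_mkcond.
by apply: eq_integral => x _; rewrite epatch_indic muleC.
Qed.

(** Both sides pass to the limit along the same increasing sequence of simple functions, by monotone
    convergence; for simple functions the identity reduces to indicators. *)
Lemma ge0_integral_densityT (g : T -> \bar R) :
  measurable_fun setT g -> (forall x, 0 <= g x) ->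
  \int[nu]_x g x = \int[mu]_x (g x * (w x)%:E).
Proof.
move=> mg g0; pose h := nnsfun_approx measurableT mg.
have gE x : g x = limn (EFin \o h ^~ x).
  by apply/esym/cvg_lim => //; exact: cvg_nnsfun_approx.
have nd x a b : (a <= b)%N -> (h a x)%:E <= (h b x)%:E.
  by move=> ab; rewrite lee_fin; exact/lefP/nd_nnsfun_approx.
rewrite [LHS](eq_integral _ _ (fun x _ => gE x)) monotone_convergence//; last 3 first.
- by move=> n; exact/measurable_EFinP.
- by move=> n x _; rewrite lee_fin.
- by move=> x _ a b; exact: nd.
rewrite (_ : (fun n => _) =
    fun n => \int[mu]_x ((h n x)%:E * (w x)%:E)); last first.
  by apply/funext => n; exact: integral_density_nnsfun.
rewrite -monotone_convergence//; last 3 first.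
- by move=> n; apply: emeasurable_funM => //; exact/measurable_EFinP.
- by move=> n x _; rewrite mule_ge0 ?lee_fin.
- by move=> x _ a b ab; rewrite lee_wpmul2r ?lee_fin//; exact: nd.
apply: eq_integral => x _; apply/cvg_lim => //.
by apply: cvgeZr => //; exact: cvg_nnsfun_approx.
Qed.

Lemma ge0_integral_density (D : set T) (g : T -> \bar R) : measurable D ->
  measurable_fun D g -> (forall x, D x -> 0 <= g x) ->
  \int[nu]_(x in D) g x = \int[mu]_(x in D) (g x * (w x)%:E).
Proof.
move=> mD mg g0; rewrite [LHS]integral_mkcond (ge0_integral_densityT (g := g \_ D)); last 2 first.
- exact/(measurable_restrictT _ mD).
- by move=> x; apply: erestrict_ge0.
rewrite [RHS]integral_mkcond; apply: eq_integral => x _.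
by rewrite /patch; case: ifPn => // _; rewrite mul0e.
Qed.

End integral_density.

(* A copy of [mu] on which the [SigmaFiniteMeasure] instance can be declared. *)
Section sigma_finite_copy.
Context d (T : measurableType d) (R : realType) (mu : {measure set T -> \bar R}).

Definition sigma_finite_copy (_ : sigma_finite setT mu) : set T -> \bar R := mu.

Hypothesis smu : sigma_finite setT mu.
HB.instance Definition _ := Measure.on (sigma_finite_copy smu).
HB.instance Definition _ :=
  Measure_isSigmaFinite.Build d T R (sigma_finite_copy smu) smu.

End sigma_finite_copy.

Lemma sigma_finite_fubini_tonelli d1 d2 (T1 : measurableType d1)
    (T2 : measurableType d2) (R : realType) (m1 : {measure set T1 -> \bar R})
    (m2 : {measure set T2 -> \bar R}) (f : T1 * T2 -> \bar R) :
  sigma_finite setT m1 -> sigma_finite setT m2 ->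
  measurable_fun setT f -> (forall z, (0 <= f z)%E) ->
  (\int[m1]_x \int[m2]_y f (x, y) = \int[m2]_y \int[m1]_x f (x, y))%E.
Proof.
move=> s1 s2 mf f0.
exact: (@fubini_tonelli _ _ _ _ _ (sigma_finite_copy s1) (sigma_finite_copy s2)).
Qed.

(** Tonelli on the region under the graph of [g]: its section at [x] is [[0, g x[], of length [g x],
    and its section at height [s] is a superlevel set, empty for [s < 0]. The same argument yields
    the measurability of the distribution function. *)
Lemma layer_cake d (T : measurableType d) (R : realType)
    (nu : {measure set T -> \bar R}) (g : T -> R) :
  sigma_finite setT nu -> measurable_fun setT g -> (forall x, 0 <= g x) ->
  measurable_fun setT (fun s : R => nu [set x | 0 <= s < g x]) /\
  (\int[nu]_x (g x)%:E =
   \int[@lebesgue_measure R]_s nu [set x | (0 <= s < g x)%R])%E.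
Proof.
move=> snu mg g0.
pose A : set (T * measurableTypeR R) := [set z | 0 <= z.2 < g z.1].
have mA : measurable A.
  rewrite (_ : A = [set z | 0 <= z.2] `&` [set z | z.2 < g z.1]); last first.
    by apply/seteqP; split => z /=; [move=> /andP|move=> /andP].
  apply: measurableI.
    have := @measurable_snd _ _ T (measurableTypeR R) measurableT `[0, +oo[%classic.
    rewrite setTI => /(_ (measurable_itv _)).
    by congr (measurable _); apply/seteqP; split => z /=; rewrite in_itv/= andbT.
  have m2 : measurable_fun setT (fun z : T * measurableTypeR R => z.2 < g z.1).
    apply: measurable_fun_ltr; first exact: measurable_snd.
    exact: (measurableT_comp mg (@measurable_fst _ _ _ _)).
  have := m2 measurableT [set true] I.
  by rewrite setTI.
have lE x : (\int[@lebesgue_measure R]_s (\1_A (x, s))%:E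
    = (g x)%:E)%E.
  rewrite (eq_integral (EFin \o \1_(`[0, g x[%classic : set (measurableTypeR R)))).
    rewrite integral_indic// setIT.
    rewrite -/(lebesgue_measure _) [LHS](lebesgue_measure_itv `[0, g x[).
    rewrite /= lte_fin; have := g0 x.
    by rewrite le_eqVlt => /orP[/eqP<-|->]; rewrite ?ltxx ?oppr0 ?adde0.
  by move=> s _ /=; rewrite !indicE; congr (_%:R%:E); apply/idP/idP;
    rewrite !inE /A/= in_itv.
have nE s : (\int[nu]_x (\1_A (x, s))%:E = nu [set x | (0 <= s < g x)%R])%E.
  rewrite (eq_integral (EFin \o \1_([set x | 0 <= s < g x]))); last first.
    by move=> x _ /=; rewrite !indicE.
  rewrite integral_indic ?setIT//.
  have /(_ measurableT _ mA) := @measurable_pair2 _ _ T (measurableTypeR R) s.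
  by rewrite setTI.
split.
  apply: (eq_measurable_fun (fubini_G nu (EFin \o \1_A))).
    by move=> s _; exact: nE.
  apply: (measurable_fun_fubini_tonelli_G (m1 := sigma_finite_copy snu)).
    exact/measurable_EFinP.
  by move=> z; rewrite lee_fin.
under eq_integral do rewrite -lE.
rewrite (@sigma_finite_fubini_tonelli _ _ _ _ _ nu lebesgue_measure
  (EFin \o \1_A))//.
- by apply: eq_integral => s _; exact: nE.
- exact: sigma_finiteT.
- exact/measurable_EFinP.
- by move=> z; rewrite lee_fin.
Qed.

(** By the layer cake formula an integral depends only on the distribution function, so functions on
    two different measure spaces can be compared. Below, one of the two spaces is the real line. *)
Lemma le_integral_tails d1 d2 (T1 : measurableType d1)
    (T2 : measurableType d2) (R : realType) (m1 : {measure set T1 -> \bar R})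
    (m2 : {measure set T2 -> \bar R}) (g1 : T1 -> R) (g2 : T2 -> R) :
  sigma_finite setT m1 -> sigma_finite setT m2 ->
  measurable_fun setT g1 -> measurable_fun setT g2 ->
  (forall x, 0 <= g1 x) -> (forall x, 0 <= g2 x) ->
  (forall s, 0 <= s -> (m1 [set x | (s < g1 x)%R] <= m2 [set x | (s < g2 x)%R])%E) ->
  (\int[m1]_x (g1 x)%:E <= \int[m2]_x (g2 x)%:E)%E.
Proof.
move=> s1 s2 mg1 mg2 g10 g20 m12.
have [ml1 ->] := layer_cake s1 mg1 g10; have [ml2 ->] := layer_cake s2 mg2 g20.
apply: ge0_le_integral => // s _.
case: (leP 0 s) => [/m12//|_] /=.
by rewrite [X in m1 X](_ : _ = set0) ?measure0//; apply/seteqP; split.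
Qed.

Lemma ge0_integral_setT_density d (T : measurableType d) (R : realType)
    (mu : {measure set T -> \bar R}) (D : set T) (mD : measurable D)
    (f : T -> \bar R) (ind0 : forall x, 0 <= \1_D x :> R) :
  measurable_fun setT f -> (forall x, (0 <= f x)%E) ->
  (\int[mu]_(x in D) f x =
   \int[density mu (measurable_indic mD) ind0]_x f x)%E.
Proof.
move=> mf f0; rewrite ge0_integral_density// integral_mkcond.
by apply: eq_integral => x _; rewrite epatch_indic.
Qed.

Lemma density_indicE d (T : measurableType d) (R : realType)
    (mu : {measure set T -> \bar R}) (D A : set T) (mD : measurable D)
    (ind0 : forall x, 0 <= \1_D x :> R) : measurable A ->
  density mu (measurable_indic mD) ind0 A = mu (A `&` D).
Proof. by move=> mA; rewrite /density integral_indic// setIC. Qed.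

Lemma indic_ge0 (T : Type) (R : numDomainType) (D : set T) x : 0 <= \1_D x :> R.
Proof. by rewrite indicE ler0n. Qed.

Lemma sigma_finite_density_indic d (T : measurableType d) (R : realType)
    (mu : {measure set T -> \bar R}) (D : set T) (mD : measurable D)
    (ind0 : forall x, 0 <= \1_D x :> R) :
  (mu D < +oo)%E \/ sigma_finite setT mu ->
  sigma_finite setT (density mu (measurable_indic mD) ind0).
Proof.
move=> [muD|[F FT Fo]].
  exists (fun=> setT); first by rewrite bigcup_const.
  by move=> _; rewrite density_indicE ?setTI.
exists F => // n; have [mF Fn] := Fo n; split => //.
by rewrite density_indicE// (le_lt_trans _ Fn)// measureIl.
Qed.

(** Restricting a measure to [D] means giving it the density [\1_D]; the restriction is sigma-finite
    if [D] has finite mass or the measure was sigma-finite already. *)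
Lemma le_integral_tails_in d1 d2 (T1 : measurableType d1)
    (T2 : measurableType d2) (R : realType) (m1 : {measure set T1 -> \bar R})
    (m2 : {measure set T2 -> \bar R}) (D1 : set T1) (D2 : set T2)
    (g1 : T1 -> R) (g2 : T2 -> R) :
  measurable D1 -> measurable D2 ->
  (m1 D1 < +oo)%E \/ sigma_finite setT m1 ->
  (m2 D2 < +oo)%E \/ sigma_finite setT m2 ->
  measurable_fun setT g1 -> measurable_fun setT g2 ->
  (forall x, 0 <= g1 x) -> (forall x, 0 <= g2 x) ->
  (forall s, 0 <= s -> (m1 (D1 `&` [set x | (s < g1 x)%R]) <=
                        m2 (D2 `&` [set x | (s < g2 x)%R]))%E) ->
  (\int[m1]_(x in D1) (g1 x)%:E <= \int[m2]_(x in D2) (g2 x)%:E)%E.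
Proof.
move=> mD1 mD2 m1D s2 mg1 mg2 g10 g20 m12.
pose i1 := @indic_ge0 _ R D1; pose i2 := @indic_ge0 _ R D2.
have ms e (T : measurableType e) (g : T -> R) s : measurable_fun setT g ->
    measurable [set x | s < g x].
  move=> mg; have := measurable_fun_ltr (measurable_cst s) mg.
  by move=> /(_ measurableT [set true] I); rewrite setTI.
rewrite (ge0_integral_setT_density m1 mD1 i1); last 2 first.
- exact/measurable_EFinP.
- by move=> x; rewrite lee_fin.
rewrite (ge0_integral_setT_density m2 mD2 i2); last 2 first.
- exact/measurable_EFinP.
- by move=> x; rewrite lee_fin.
apply: le_integral_tails => //.
- exact: sigma_finite_density_indic.
- exact: sigma_finite_density_indic.
- by move=> s s0; rewrite /= !density_indicE//; [rewrite setIC [X in m2 X]setIC; exact: m12|exact: ms|exact: ms].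
Qed.

(** * Hoelder's inequality for powers with exponents summing to 1 *)

Section holder.
Context d (T : measurableType d) (R : realType).
Implicit Types (mu : {measure set T -> \bar R}) (f g : T -> R) (t : R).
Local Open Scope ereal_scope.

Let holder_lt1 mu f g t : (0 < t < 1)%R ->
  measurable_fun setT f -> measurable_fun setT g ->
  (forall x, 0 <= f x)%R -> (forall x, 0 <= g x)%R ->
  \int[mu]_x (f x `^ t * g x `^ (1 - t))%:E <=
  (\int[mu]_x (f x)%:E) `^ t * (\int[mu]_x (g x)%:E) `^ (1 - t).
Proof.
move=> /andP[t0 t1] mf mg f0 g0.
have t1' : (0 < 1 - t)%R by rewrite subr_gt0.
have := @hoelder _ _ _ mu (fun x => f x `^ t)%R (fun x => g x `^ (1 - t))%R
  t^-1 (1 - t)^-1 (measurable_fun_powR _ mf) (measurable_fun_powR _ mg).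
rewrite !invr_gt0 !invrK subrKC => /(_ t0 t1' erefl).
rewrite Lnorm1 unlock !invrK.
under eq_integral do rewrite gee0_abs ?lee_fin ?mulr_ge0 ?powR_ge0//.
move=> /le_trans; apply.
rewrite le_eqVlt; apply/orP; left; apply/eqP; congr (_ `^ _ * _ `^ _).
- apply: eq_integral => x _; rewrite /= ger0_norm ?powR_ge0//.
  by rewrite -powRrM divff ?gt_eqF// powRr1.
- apply: eq_integral => x _; rewrite /= ger0_norm ?powR_ge0//.
  by rewrite -powRrM divff ?gt_eqF// powRr1.
Qed.

(** Hoelder's inequality for [f]^ t[and]g [^ (1 - t)] with exponents [t^-1] and [(1 - t)^-1]. The
    endpoint [t = 1] serves the case [p = q] and holds because every power with exponent 0 is 1,
    also at 0 and at [+oo]. *)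
Lemma ge0_integral_powR_holder mu (D : set T) f g t : (0 < t <= 1)%R ->
  measurable D -> measurable_fun setT f -> measurable_fun setT g ->
  (forall x, 0 <= f x)%R -> (forall x, 0 <= g x)%R ->
  \int[mu]_(x in D) (f x `^ t * g x `^ (1 - t))%:E <=
  (\int[mu]_(x in D) (f x)%:E) `^ t * (\int[mu]_(x in D) (g x)%:E) `^ (1 - t).
Proof.
move=> /andP[t0 t1] mD mf mg f0 g0.
move: t1; rewrite le_eqVlt => /orP[/eqP->|t1].
  rewrite subrr poweRe0 mule1 poweRe1; last first.
    by apply: integral_ge0 => x _; rewrite lee_fin.
  by under eq_integral do rewrite powRr0 mulr1 powRr1//.
rewrite !(ge0_integral_setT_density mu mD (@indic_ge0 _ R D)).
- by apply: holder_lt1 => //; rewrite t0 t1.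
- exact/measurable_EFinP.
- by move=> x; rewrite lee_fin.
- exact/measurable_EFinP.
- by move=> x; rewrite lee_fin.
- by apply/measurable_EFinP/measurable_funM; exact: measurable_fun_powR.
- by move=> x; rewrite lee_fin mulr_ge0 ?powR_ge0.
Qed.

End holder.

(** * Integrals of powers *)

Section powR_calculus.
Context {R : realType}.
Implicit Types c m t : R.

Lemma continuous_powR_gt0 c t : 0 < t -> {for t, continuous (fun s : R => s `^ c)}.
Proof.
move=> t0; apply/differentiable_continuous/derivable1_diffP.
by apply: derivable_powR; rewrite in_itv/= andbT.
Qed.

Lemma is_derive_powR_div c t : 0 < t -> c != 0 ->
  is_derive t 1 (fun s : R => s `^ c / c) (t `^ (c - 1)).
Proof.
move=> t0 c0.
have d1 : derivable (fun s : R => s `^ c) t (1 : R).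
  by apply: derivable_powR; rewrite in_itv/= andbT.
have e1 : 'D_1 (fun s : R => s `^ c) t = c * t `^ (c - 1).
  by rewrite -derive1E powR_derive1// in_itv/= andbT.
have -> : (fun s : R => s `^ c / c) = c^-1 \*: (fun s : R => s `^ c).
  by apply/funext => s /=; rewrite /GRing.scale/= mulrC.
have /derivableP D1 := d1.
have := is_deriveZ c^-1 D1; rewrite e1.
by rewrite /GRing.scale/= mulrA mulVf// mul1r.
Qed.

Lemma integral_powR c t : 0 <= t -> 0 < c ->
  (\int[lebesgue_measure]_(s in `[0%R, t]) (s `^ c)%:E =
   (t `^ (c + 1) / (c + 1))%:E)%E.
Proof.
rewrite le_eqVlt => /orP[/eqP<- c0|t0 c0].
  by rewrite set_itv1 integral_set1 powR0 ?mul0r// gt_eqF// addr_gt0.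
have c10 : 0 < c + 1 by rewrite addr_gt0.
have cvg0 b : 0 < b -> s `^ b @[s --> 0^'+] --> 0 `^ b.
  by move=> b0; rewrite powR0 ?gt_eqF//; exact: powR_cvg0.
have cvgt b : s `^ b @[s --> t^'-] --> t `^ b.
  by apply: cvg_at_left_filter; exact: continuous_powR_gt0.
rewrite (@continuous_FTC2 _ (fun s => s `^ c) (fun s => s `^ (c + 1) / (c + 1)))//.
- by rewrite powR0 ?gt_eqF// mul0r sube0.
- apply/continuous_within_itvP => //; split; [|exact: cvg0|exact: cvgt].
  move=> s; rewrite in_itv/= => /andP[s0 _]; exact: continuous_powR_gt0.
- split.
  + move=> s; rewrite in_itv/= => /andP[s0 _].
    by have [] := is_derive_powR_div s0 (lt0r_neq0 c10).
  + by apply: cvgMl; exact: cvg0.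
  + by apply: cvgMl; exact: cvgt.
- move=> s; rewrite in_itv/= => /andP[s0 _].
  have [_] := is_derive_powR_div s0 (lt0r_neq0 c10).
  by rewrite derive1E addrK.
Qed.

Lemma powRN_cvgy c : 0 < c -> (t : R) `^ (- c) @[t --> +oo] --> 0.
Proof.
move=> c0; apply/cvgrPdist_le => e e0; near=> t.
rewrite sub0r normrN ger0_norm ?powR_ge0//.
have b0 : 0 < e `^ (- c^-1) by exact: powR_gt0.
have bt : e `^ (- c^-1) <= t by near: t; exact: nbhs_pinfty_ge.
have t0 : 0 < t := lt_le_trans b0 bt.
rewrite powRN invf_ple ?posrE ?powR_gt0//.
rewrite -[leLHS](_ : (e `^ (- c^-1)) `^ c = _); last first.
  by rewrite -powRrM mulNr mulVf ?gt_eqF// powR_inv1 ?ltW.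
by rewrite ge0_ler_powR// ?nnegrE ?ltW.
Unshelve. all: by end_near. Qed.

Lemma integral_powRN c t : 0 < t -> 1 < c ->
  (\int[lebesgue_measure]_(s in `[t, +oo[) (s `^ (- c))%:E =
   (t `^ (1 - c) / (c - 1))%:E)%E.
Proof.
move=> t0 c1.
have c10 : 1 - c < 0 by rewrite subr_lt0.
have cE : 1 - c != 0 by rewrite lt_eqF.
rewrite (@ge0_continuous_FTC2y _ (fun s => s `^ (- c))
   (fun s => s `^ (1 - c) / (1 - c)) _ 0).
- by rewrite add0e -EFinN -mulrN -invrN opprB.
- by move=> s _; exact: powR_ge0.
- apply/continuous_within_itvcyP; split.
    move=> s; rewrite in_itv/= andbT => ts.
    by apply: continuous_powR_gt0; exact: lt_trans ts.
  by apply: cvg_at_right_filter; exact: continuous_powR_gt0.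
- rewrite -[0 in X in _ --> X](mul0r (1 - c)^-1); apply: cvgMl.
  by rewrite -[1 - c]opprB; apply: powRN_cvgy; rewrite subr_gt0.
- move=> s ts.
  by have [] := is_derive_powR_div (lt_trans t0 ts) cE.
- by apply: cvgMl; apply: cvg_at_right_filter; exact: continuous_powR_gt0.
- move=> s; rewrite in_itv/= andbT => ts.
  have [_] := is_derive_powR_div (lt_trans t0 ts) cE.
  by rewrite derive1E addrAC subrr add0r.
Qed.
End powR_calculus.

(** * Tails of measures on a metric space *)

Section outer_measure.
Context {d : measure_display} {R : realType} {X : borelMetricType d R}.
Variables (a : X) (nu : {measure set X -> \bar R}).
Implicit Types (x y : X) (r s t : R) (P : set X).

Lemma borelMetric_measurable_ball r : measurable (ball a r).
Proof.
have [r0|r0] := ltP 0 r; last first.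
  rewrite (_ : ball a r = set0) ?measurable0//; apply/seteqP; split => // y.
  rewrite ballEmdist/= => yr.
  by have := mdist_ge0 a y; rewrite leNgt (lt_le_trans yr).
rewrite borelE; apply: sub_sigma_algebra; rewrite openE => y.
rewrite ballEmdist/= => yr; apply/nbhs_ballP.
exists (r - mdist a y); first by rewrite /= subr_gt0.
move=> z; rewrite ballEmdist/= ltrBrDl.
by apply: le_lt_trans; exact: metric_triangle.
Qed.

Lemma setC_ballE r : ~` ball a r = [set y | r <= mdist a y].
Proof. by rewrite ballEmdist; apply/seteqP; split => y /=; rewrite leNgt => /negP. Qed.

Lemma measurable_outer r : measurable (~` ball a r).
Proof. exact/measurableC/borelMetric_measurable_ball. Qed.

Lemma measurable_mdist : measurable_fun setT (mdist a).
Proof.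
apply: (measurability (@RGenCInfty.G R)) => [|/= _ [_] [r] -> <-].
  exact: RGenCInfty.measurableE.
rewrite setTI (_ : _ @^-1` _ = ~` ball a r); first exact: measurable_outer.
by rewrite setC_ballE; apply/seteqP; split => y /=; rewrite in_itv/= andbT.
Qed.

Lemma msphereE r : msphere a r = [set x | mdist a x = r].
Proof. by apply/seteqP; split => x /=; rewrite /msphere/= metric_sym. Qed.

Lemma subset_outer r s : r <= s -> ~` ball a s `<=` ~` ball a r.
Proof. by move=> rs; rewrite !setC_ballE => y /=; exact: le_trans. Qed.

Lemma le_outer r s : r <= s -> (nu (~` ball a s) <= nu (~` ball a r))%E.
Proof.
by move=> rs; apply: le_measure; rewrite ?inE//; [exact: measurable_outer..|exact: subset_outer].
Qed.

Lemma measurable_nu_outer :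
  measurable_fun setT (fun x => nu (~` ball a (mdist a x))).
Proof.
(* The tail is non-increasing in the radius, so preimages of upper rays are intervals. *)
have mphi : measurable_fun setT (fun r => nu (~` ball a r)).
  apply: (measurability _ (ErealGenCInfty.measurableE R)) => /= _ [_ [y ->] <-].
  rewrite setTI; apply: is_interval_measurable => s t/=.
  rewrite !in_itv/= !andbT => fs ft u /andP[su ut].
  by rewrite in_itv/= andbT (le_trans ft)// le_outer.
exact: (measurableT_comp mphi measurable_mdist).
Qed.

(* The sets [P] with infimal radius not attained are handled by continuity
   from below. *)
Lemma measure_le_outer P (t : \bar R) : measurable P ->
  (0 <= t)%E ->
  (forall x, P x -> (nu (~` ball a (mdist a x)) <= t)%E) -> (nu P <= t)%E.
Proof.
move=> mP t0 Pt.
have [->|/set0P[x0 Px0]] := eqVneq P set0; first by rewrite measure0.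
pose S := mdist a @` P.
have iS : has_inf S.
  split; first by exists (mdist a x0), x0.
  by exists 0 => _ [x _ <-]; exact: mdist_ge0.
have lS x : P x -> inf S <= mdist a x.
  by move=> Px; apply: ge_inf; [exact: iS.2|exists x].
have [[x [Px xS]]|nS] := pselect (exists x, P x /\ mdist a x = inf S).
  apply: le_trans (Pt _ Px); apply: le_measure; rewrite ?inE//.
    exact: measurable_outer.
  by rewrite setC_ballE xS => y /= /lS.
pose F n := P `&` ~` ball a (inf S + n.+1%:R^-1).
have mF n : measurable (F n) by apply: measurableI => //; exact: measurable_outer.
have PF : P = \bigcup_n F n.
  apply/seteqP; split => [x Px|x [n _ []//]].
  have : inf S < mdist a x.
    rewrite lt_neqAle lS// andbT; apply/eqP => e; apply: nS; exists x.
    by split.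
  move=> /ltr_add_invr[n nx]; exists n => //; split => //.
  by rewrite setC_ballE/= ltW.
have ndF : {homo F : n m / (n <= m)%N >-> (n <= m)%O}.
  move=> n m nm; apply/subsetPset; apply: setIS; apply: subset_outer.
  by rewrite lerD2l lef_pV2 ?posrE ?ltr0n// ler_nat.
have cF := nondecreasing_cvg_mu (mu := nu) mF (bigcupT_measurable _ mF) ndF.
rewrite PF -(cvg_lim _ cF)//; apply: lime_le; first by apply/cvg_ex; exists (nu (\bigcup_n F n)).
apply: nearW => n /=.
have [_ [x Px <-] xn] : exists2 s, S s & s < inf S + n.+1%:R^-1.
  by apply: inf_adherent => //; rewrite invr_gt0 ltr0n.
apply: le_trans (Pt _ Px); apply: le_measure; rewrite ?inE//.
  exact: measurable_outer.
by apply: subset_trans (@subIsetr _ _ _) _; exact/subset_outer/ltW.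
Qed.

Local Notation tail x := (nu (~` ball a (mdist a x))).

Lemma measurable_tail_powR c :
  measurable_fun setT (fun x => fine (tail x) `^ c).
Proof.
apply: measurable_fun_powR.
exact: (measurableT_comp (fine_measurable measurableT) measurable_nu_outer).
Qed.

Lemma integral_tail_powR_ge (r c : R) : 0 < c -> (nu (~` ball a r) < +oo)%E ->
  ((fine (nu (~` ball a r)) `^ (c + 1) / (c + 1))%:E <=
   \int[nu]_(x in ~` ball a r) (fine (tail x) `^ c)%:E)%E.
Proof.
move=> c0 Noo; have mN := measurable_outer r.
set T := fine _; have T0 : 0 <= T by exact: fine_ge0.
have TE : nu (~` ball a r) = T%:E by rewrite fineK// ge0_fin_numE.
have tl x : (~` ball a r) x -> (tail x < +oo)%E.
  by rewrite setC_ballE => rx; apply: le_lt_trans Noo; exact: le_outer.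
have lebT z : lebesgue_measure (`]z, T]%classic : set R) =
    (if z < T then (T - z)%:E else 0%E).
  by rewrite lebesgue_measure_itv/= lte_fin -EFinB.
have leb0T : (lebesgue_measure (`[0%R, T]%classic : set R) < +oo)%E.
  by rewrite lebesgue_measure_itv/=; case: ifP => _; rewrite -?EFinB ltry.
rewrite -integral_powR//; apply: le_integral_tails_in => //.
- by left.
- by left.
- exact: measurable_tail_powR.
- by move=> s; exact: powR_ge0.
move=> s s0; pose z := s `^ c^-1.
have z0 : 0 <= z by exact: powR_ge0.
have zc : z `^ c = s by rewrite -powRrM mulVf ?gt_eqF// powRr1.
pose P := ~` ball a r `&` [set x | (tail x <= z%:E)%E].
have mP : measurable P.
  apply: measurableI => //; rewrite -[X in measurable X]setTI.
  by apply: emeasurable_fun_infty_c => //; exact: measurable_nu_outer.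
have Pz : (nu P <= z%:E)%E by apply: measure_le_outer => // x [].
have mc e (T' : measurableType e) (g : T' -> R) : measurable_fun setT g ->
    measurable [set x | s < g x].
  move=> mg; have := measurable_fun_ltr (measurable_cst s) mg.
  by move=> /(_ measurableT [set true] I); rewrite setTI.
pose Q := ~` ball a r `&` [set x | s < fine (tail x) `^ c].
have mQ : measurable Q.
  by apply: measurableI => //; apply: mc; exact: measurable_tail_powR.
apply: (@le_trans _ _ (lebesgue_measure (`]z, T]%classic : set R))).
  apply: le_measure; rewrite ?inE//.
    by apply: measurableI => //; apply: mc; exact: measurable_powR.
  move=> t /= [+ st]; rewrite !in_itv/= => /andP[t0 ->]; rewrite andbT.
  rewrite ltNge; apply/negP => tz.
  by move: st; rewrite -zc ltNge ge0_ler_powR// ltW.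
rewrite lebT; case: ifP => // zT.
rewrite EFinB leeBlDl// -TE; apply: le_trans (leeD Pz (lexx _)).
apply: (@le_trans _ _ (nu (P `|` Q))); last exact: measureU2.
apply: le_measure; rewrite ?inE//; first exact: measurableU.
move=> x Nx; have [xz|zx] := leP (tail x) z%:E; [by left|right].
split => //=; rewrite -zc gt0_ltr_powR// ?nnegrE ?fine_ge0//.
by rewrite -lte_fin fineK// ge0_fin_numE// tl.
Qed.

Lemma integral_tail_powR_le (Z : set X) (r c : R) : 1 < c -> measurable Z ->
  nu (msphere a r) = 0%E -> (nu [set x | (mdist a x <= r)%R] < +oo)%E ->
  (0 < nu (~` ball a r) < +oo)%E -> (forall x, Z x -> (tail x < +oo)%E) ->
  (\int[nu]_(x in Z `&` [set x | (mdist a x <= r)%R])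
     (fine (tail x) `^ (- c))%:E <=
   (fine (nu (~` ball a r)) `^ (1 - c) / (c - 1))%:E)%E.
Proof.
move=> c1 mZ S0 Boo /andP[N0 Noo] Zoo.
have c0 : 0 < c by exact: lt_trans c1.
have mN := measurable_outer r.
set m := fine _; have m0 : 0 < m by rewrite fine_gt0// N0.
have mE : nu (~` ball a r) = m%:E by rewrite fineK// ge0_fin_numE// ltW.
have mle : measurable [set x | mdist a x <= r].
  have := measurable_fun_ler measurable_mdist (measurable_cst r).
  by move=> /(_ measurableT [set true] I); rewrite setTI.
have mlt : measurable [set x | r < mdist a x].
  have := measurable_fun_ltr (measurable_cst r) measurable_mdist.
  by move=> /(_ measurableT [set true] I); rewrite setTI.
have mD := measurableI _ _ mZ mle.
have mc e (T' : measurableType e) (g : T' -> R) s : measurable_fun setT g ->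
    measurable [set x | s < g x].
  move=> mg; have := measurable_fun_ltr (measurable_cst s) mg.
  by move=> /(_ measurableT [set true] I); rewrite setTI.
(* Since the sphere is null, the open exterior, which is disjoint from the closed ball, carries the
   full tail mass [m]. *)
have lt_mE : nu [set x | r < mdist a x] = m%:E.
  rewrite -mE setC_ballE.
  rewrite (_ : [set y | r <= mdist a y] =
      msphere a r `|` [set x | r < mdist a x]); last first.
    rewrite msphereE; apply/seteqP; split => x /=.
      rewrite le_eqVlt => /orP[/eqP rx|rx]; last by right.
      by left.
    by case=> [->//|]; exact: ltW.
  rewrite measureU//; [by rewrite /= S0 add0e| | ].
  - rewrite (_ : msphere a r = [set x | mdist a x <= r] `\` ball a r).
      by apply: measurableD => //; exact: borelMetric_measurable_ball.
    rewrite msphereE setDE setC_ballE; apply/seteqP; split => x /=.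
      by move=> ->; split.
    by move=> [? ?]; apply/eqP; rewrite eq_le; apply/andP.
  - by rewrite msphereE; apply/seteqP; split => // x [] /= ->; rewrite ltxx.
rewrite -integral_powRN//; apply: le_integral_tails_in => //.
- left; apply: le_lt_trans Boo; apply: le_measure; rewrite ?inE//.
- right; exact: sigma_finiteT.
- exact: measurable_tail_powR.
- by move=> s; exact: powR_ge0.
(* At level 0 the set on the line is the whole of [[m, +oo[], of infinite length. *)
move=> s; rewrite le_eqVlt => /orP[/eqP<-|s0].
  rewrite (_ : _ `&` [set x : R | _] = `[m, +oo[%classic); last first.
    apply/seteqP; split => x /=; first by case.
    move=> mx; split => //; apply: powR_gt0.
    by move: mx; rewrite in_itv/= andbT; exact: lt_le_trans.
  have lbo : (+oo <= lebesgue_measure (`[m, +oo[%classic : set R))%E.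
    by rewrite lebesgue_measure_itv/= ltry.
  exact: le_trans (leey _) lbo.
pose z := s `^ (- c^-1).
have z0 : 0 < z by exact: powR_gt0.
have zc : z `^ (- c) = s.
  by rewrite -powRrM mulrNN mulVf ?gt_eqF// powRr1// ltW.
have ltz t : 0 < t -> (s < t `^ (- c)) = (t < z).
  move=> t0; apply/idP/idP => [|tz].
    rewrite -zc !powRN ltf_pV2 ?posrE ?powR_gt0// => h.
    rewrite ltNge; apply/negP => zt; move: h.
    by rewrite ltNge ge0_ler_powR// ?nnegrE ltW.
  by rewrite -zc !powRN ltf_pV2 ?posrE ?powR_gt0// gt0_ltr_powR// ?nnegrE ltW.
have lbS : (lebesgue_measure (`[m, z[%classic : set R) <= lebesgue_measure
    ((`[m, +oo[%classic : set R) `&` [set x : R | (s < x `^ (- c))%R]))%E.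
  apply: le_measure; rewrite ?inE//.
    by apply: measurableI => //; apply: mc; exact: measurable_powR.
  move=> t /=; rewrite !in_itv/= andbT => /andP[mt tz]; split => //.
  by rewrite ltz// (lt_le_trans m0).
apply: le_trans lbS; rewrite lebesgue_measure_itv/= lte_fin.
set P := _ `&` _.
have mP : measurable P.
  by apply: measurableI => //; apply: mc; exact: measurable_tail_powR.
have Pm x : P x -> (m%:E <= tail x)%E.
  by move=> [[_ /= xr] _]; rewrite -mE; exact: le_outer.
have tE x : P x -> tail x = (fine (tail x))%:E.
  by move=> [[/Zoo Zx _] _]; rewrite fineK// ge0_fin_numE.
have Pz x : P x -> fine (tail x) < z.
  move=> Px; rewrite -ltz; last first.
    by rewrite (lt_le_trans m0)// -lee_fin -tE// Pm.
  by case: Px => _.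
have zP x : P x -> m < z.
  by move=> Px; rewrite (le_lt_trans _ (Pz _ Px))// -lee_fin -tE// Pm.
case: ifPn => [mz|/negP mz]; last first.
  by rewrite (_ : P = set0) ?measure0//; apply/seteqP; split => // x /zP.
rewrite -EFinB EFinB leeBrDr// -lt_mE -measureU//; last first.
  apply/seteqP; split => // x [[[_ /= xr] _]] /=.
  by rewrite ltNge xr.
apply: measure_le_outer; first exact: measurableU.
  by rewrite lee_fin ltW.
move=> x [Px|rx]; first by rewrite tE// lee_fin ltW// Pz.
apply: (@le_trans _ _ m%:E); last by rewrite lee_fin ltW.
by rewrite -mE; apply: le_outer; exact: ltW.
Qed.

End outer_measure.

(** * Powers on [[0, +oo]] *)

Section epow.
Context {R : realType}.
Implicit Types (x y : \bar R) (r s : R).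

Lemma epow0r r : r < 0 -> epow 0 r = +oo%E.
Proof. by move=> r0; rewrite /epow r0 poweR0r ?inve0// oppr_eq0 lt_eqF. Qed.

Lemma epowyr r : r < 0 -> epow +oo r = 0%E.
Proof. by move=> r0; rewrite /epow r0 poweRyr ?invey// oppr_eq0 lt_eqF. Qed.

Lemma epow_EFin s r : 0 < s -> epow s%:E r = (s `^ r)%:E.
Proof.
move=> s0; rewrite /epow; case: ifP => // _.
by rewrite poweR_EFin powRN inver invr_eq0 gt_eqF ?powR_gt0// invrK.
Qed.

Lemma epow_ge0 x r : (0 <= epow x r)%E.
Proof. by rewrite /epow; case: ifP => _; rewrite ?inve_ge0 poweR_ge0. Qed.

Lemma le_epow r x y : r < 0 -> (0 <= x)%E -> (x <= y)%E ->
  (epow y r <= epow x r)%E.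
Proof.
move=> r0; case: x => [x| |]//; last first.
  by move=> _; rewrite leye_eq => /eqP->.
rewrite lee_fin le_eqVlt => /orP[/eqP<- _|x0]; first by rewrite epow0r// leey.
case: y => [y| |]//; last by rewrite epowyr// epow_ge0.
rewrite lee_fin => xy; have y0 := lt_le_trans x0 xy.
rewrite !epow_EFin// lee_fin -[r]opprK !(powRN _ (- r)).
by rewrite lef_pV2 ?posrE ?powR_gt0// ge0_ler_powR// ?nnegrE ?oppr_ge0 ltW.
Qed.

End epow.

(** * Spheres and the polar decomposition *)

Section polar.
Context {d : measure_display} {R : realType} {X : borelMetricType d R}.
Variables (mu : {measure set X -> \bar R}) (a : X).

Lemma measurable_msphere r : measurable (msphere a r).
Proof.
rewrite (_ : msphere a r = [set x | mdist a x <= r] `\` ball a r).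
  apply: measurableD => //; last exact: borelMetric_measurable_ball.
  have := measurable_fun_ler (measurable_mdist a) (measurable_cst r).
  by move=> /(_ measurableT [set true] I); rewrite setTI.
rewrite msphereE setDE setC_ballE; apply/seteqP; split => x /=.
  by move=> ->; split.
by move=> [? ?]; apply/eqP; rewrite eq_le; apply/andP.
Qed.

(* Testing the polar decomposition with [u] cut off to one sphere: the outer
   integrand vanishes off a single radius. *)
Lemma integral_msphere_eq0 (u : X -> R) r : polar_decomposition mu a ->
  loc_integrable mu u -> (\int[mu]_(x in msphere a r) (u x)%:E = 0)%E.
Proof.
move=> [lambda [sigma [_ polar]]] [mu_ intu].
have mS := measurable_msphere r.
have iS : mu.-integrable (msphere a r) (EFin \o u).
  apply: (integrableS (borelMetric_measurable_ball a (r + 1))) (intu a _) => //.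
  by rewrite msphereE ballEmdist => x /= ->; rewrite ltrDl.
pose f : X -> R := u \_ (msphere a r).
have fE : EFin \o f = (EFin \o u) \_ (msphere a r).
  by apply/funext => x; rewrite /f /patch/=; case: ifP.
have if_ : mu.-integrable setT (EFin \o f).
  by rewrite fE; apply/(integrable_mkcond _ mS).
transitivity (\int[mu]_x (f x)%:E)%E.
  by rewrite integral_mkcond; apply: eq_integral => x _; rewrite -[RHS]/((EFin \o f) x) fE.
rewrite (polar f if_).
pose g s := (\int[sigma s]_(x in msphere a s) (f x * lambda x)%:E)%E.
transitivity (\int[@lebesgue_measure R]_(s in `]0%R, +oo[) (g \_ [set r]) s)%E.
  apply: eq_integral => s _; rewrite /patch; case: ifPn => //.
  rewrite notin_setE/= => sr; rewrite /g integral0_eq// => x xs.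
  rewrite /f patchN ?mul0r// notin_setE => xr; apply: sr.
  by rewrite -xr -xs.
by rewrite -integral_mkcondr (@integral_Sset1 _ _ _ r)//; exact: subIsetr.
Qed.

End polar.

Section measurable_epow.
Context d (T : measurableType d) (R : realType).

Lemma epow_EFinE (s r : R) : r < 0 ->
  epow s%:E r = (if s == 0%R then +oo else (s `^ r)%:E)%E.
Proof.
move=> r0; have [->|s0] := eqVneq s 0; first by rewrite epow0r.
by rewrite /epow r0 poweR_EFin powRN inver invr_eq0 powR_eq0 (negbTE s0) invrK.
Qed.

Lemma measurable_fun_epow_EFin (f : T -> R) r : r < 0 ->
  measurable_fun setT f -> measurable_fun setT (fun x => epow (f x)%:E r).
Proof.
move=> r0 mf; under eq_fun do rewrite epow_EFinE//.
apply: measurable_fun_ifT => //.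
  exact: measurable_fun_eqr.
by apply/measurable_EFinP/measurable_fun_powR.
Qed.

Lemma measurable_fun_epow (F : T -> \bar R) r : r < 0 ->
  (forall x, (0 <= F x)%E) ->
  measurable_fun setT F -> measurable_fun setT (fun x => epow (F x) r).
Proof.
move=> r0 F0 mF.
have -> : (fun x => epow (F x) r) =
    (fun x => if F x == +oo then 0 else epow (fine (F x))%:E r)%E.
  apply/funext => x; case: (F x) (F0 x) => //= _; first by rewrite epowyr.
apply: measurable_fun_ifT => //.
  by apply: measurable_fun_eqe.
apply: measurable_fun_epow_EFin => //.
exact: (measurableT_comp (fine_measurable measurableT)).
Qed.
End measurable_epow.

Lemma le_powR_neg (R : realType) (r x y : R) : r < 0 -> 0 < x -> x <= y ->
  y `^ r <= x `^ r.
Proof.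
move=> r0 x0 xy; have y0 := lt_le_trans x0 xy.
rewrite -[r]opprK !(powRN _ (- r)).
by rewrite lef_pV2 ?posrE ?powR_gt0// ge0_ler_powR// ?nnegrE ?oppr_ge0 ltW.
Qed.

Lemma epow_gt0E (R : realType) (x : \bar R) (r : R) : 0 < r ->
  epow x r = (x `^ r)%E.
Proof. by move=> r0; rewrite /epow ltNge ltW. Qed.

Lemma powR_cancel (R : realType) (x r : R) : 0 <= x -> r != 0 ->
  (x `^ r^-1) `^ r = x.
Proof. by move=> x0 r0; rewrite -powRrM mulVf// powRr1. Qed.

(** Writing positive reals as exponentials turns identities between products of powers into rational
    identities between exponents, which [field] decides. *)
Lemma powR_expR (R : realType) (l r : R) : expR l `^ r = expR (r * l).
Proof. by rewrite /powR gt_eqF ?expR_gt0// expRK. Qed.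

Lemma gt0_expR (R : realType) (x : R) : 0 < x -> {l | x = expR l}.
Proof. by move=> x0; exists (ln x); rewrite lnK ?posrE. Qed.

(** Both iterated integrals run over the pairs with [mdist a x <= mdist a y]. The measurability of
    the inner integral comes with the exchange and is needed to bound the result afterwards. *)
Lemma tonelli_outer {d : measure_display} {R : realType}
    {X : borelMetricType d R} (a : X) (nu beta : {measure set X -> \bar R})
    (c k : X -> R) : sigma_finite setT nu -> sigma_finite setT beta ->
  measurable_fun setT c -> measurable_fun setT k ->
  (forall x, 0 <= c x) -> (forall x, 0 <= k x) ->
  measurable_fun setT (fun y => ((k y)%:E *
     \int[nu]_(x in [set x | (mdist a x <= mdist a y)%R]) (c x)%:E)%E) /\
  (\int[nu]_x ((c x)%:E * \int[beta]_(y in ~` ball a (mdist a x)) (k y)%:E) =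
   \int[beta]_y ((k y)%:E *
     \int[nu]_(x in [set x | (mdist a x <= mdist a y)%R]) (c x)%:E))%E.
Proof.
move=> snu sbeta mc mk c0 k0.
pose S := [set z : X * X | mdist a z.1 <= mdist a z.2].
have mS : measurable S.
  have m1 := measurableT_comp (measurable_mdist a) (@measurable_fst _ _ X X).
  have m2 := measurableT_comp (measurable_mdist a) (@measurable_snd _ _ X X).
  have := measurable_fun_ler m1 m2.
  by move=> /(_ measurableT [set true] I); rewrite setTI.
pose H (z : X * X) := (c z.1 * k z.2 * \1_S z)%:E.
have mH : measurable_fun setT H.
  apply/measurable_EFinP/measurable_funM; last exact: measurable_indic.
  apply: measurable_funM.
    exact: (measurableT_comp mc (@measurable_fst _ _ X X)).
  exact: (measurableT_comp mk (@measurable_snd _ _ X X)).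
have H0 z : (0 <= H z)%E by rewrite lee_fin !mulr_ge0 ?indic_ge0.
have HG y : (\int[nu]_x H (x, y) = (k y)%:E *
     \int[nu]_(x in [set x | (mdist a x <= mdist a y)%R]) (c x)%:E)%E.
  rewrite [in RHS]integral_mkcond.
  have mD : measurable [set x | mdist a x <= mdist a y].
    have := measurable_fun_ler (measurable_mdist a) (measurable_cst (mdist a y)).
    by move=> /(_ measurableT [set true] I); rewrite setTI.
  symmetry; rewrite -ge0_integralZl//; last 3 first.
  - by apply/(measurable_restrictT _ mD)/measurable_funTS/measurable_EFinP.
  - by move=> x _; apply: erestrict_ge0 => z _; rewrite lee_fin.
  - by rewrite lee_fin.
  apply: eq_integral => x _; rewrite epatch_indic /H /= -!EFinM mulrA.
  rewrite [k y * _]mulrC.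
  by congr (_ * _)%:E; rewrite !indicE; congr (_%:R);
      apply/idP/idP; rewrite !inE.
split.
  apply: (eq_measurable_fun (fubini_G nu H)); first by move=> y _; exact: HG.
  exact: (measurable_fun_fubini_tonelli_G (m1 := sigma_finite_copy snu)).
transitivity (\int[nu]_x \int[beta]_y H (x, y))%E.
  apply: eq_integral => x _; rewrite [in LHS]integral_mkcond.
  have mN := measurable_outer a (mdist a x).
  rewrite -ge0_integralZl//; last 3 first.
  - by apply/(measurable_restrictT _ mN)/measurable_funTS/measurable_EFinP.
  - by move=> y _; apply: erestrict_ge0 => z _; rewrite lee_fin.
  - by rewrite lee_fin.
  apply: eq_integral => y _; rewrite epatch_indic /H /= -!EFinM mulrA.
  by congr (_ * _)%:E; rewrite setC_ballE !indicE; congr (_%:R);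
    apply/idP/idP; rewrite !inE.
rewrite sigma_finite_fubini_tonelli//.
by apply: eq_integral => y _; exact: HG.
Qed.

(** * Necessity *)

Section upper_mule.
Context {R : realType}.
Implicit Types (x y : \bar R).
Local Open Scope ereal_scope.

Lemma upper_mulexy x : 0 <= x -> upper_mule x +oo = +oo.
Proof.
rewrite /upper_mule le_eqVlt => /orP[/eqP<-|x0]; first by rewrite !eqxx.
by case: ifP => // _; rewrite gt0_muley.
Qed.

Lemma upper_muleyx x : 0 <= x -> upper_mule +oo x = +oo.
Proof.
rewrite /upper_mule le_eqVlt => /orP[/eqP<-|x0]; first by rewrite !eqxx.
by case: ifP => // _; rewrite gt0_mulye.
Qed.

Lemma upper_mule_fin x y : x < +oo -> y < +oo -> upper_mule x y = x * y.
Proof. by rewrite /upper_mule => /lt_eqF-> /lt_eqF->; rewrite andbF. Qed.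

End upper_mule.

(** The integral is a tail of the measure with density [f]. *)
Lemma measurable_integral_outer {R : realType} {d : measure_display}
    {X : borelMetricType d R} (mu : {measure set X -> \bar R}) (a : X)
    (f : X -> R) : measurable_fun setT f -> (forall x, 0 <= f x) ->
  measurable_fun setT
    (fun x => \int[mu]_(y in ~` ball a (mdist a x)) (f y)%:E)%E.
Proof. by move=> mf f0; exact: (measurable_nu_outer a (density mu mf f0)). Qed.

Section hardy.
Context {R : realType} {d : measure_display} {X : borelMetricType d R}.
Variables (mu : {measure set X -> \bar R}) (a : X).
Variables (p q p' : R) (u v : X -> R).
Hypotheses (hqp : q <= p) (hp : p < 0) (hp' : p^-1 + p'^-1 = 1).
Hypotheses (hu0 : forall x, 0 <= u x) (hv0 : forall x, 0 <= v x).
Hypotheses (hu : loc_integrable mu u) (hv : loc_integrable mu v).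

Local Notation w := (fun y => v y `^ (1 - p')).
Local Notation N r := (~` ball a r).

Let hq : q < 0. Proof. exact: le_lt_trans hp. Qed.
Let mu_ : measurable_fun setT u. Proof. by have [] := hu. Qed.
Let mv : measurable_fun setT v. Proof. by have [] := hv. Qed.

Let p'V : p'^-1 = 1 - p^-1. Proof. by rewrite -hp' addrC addKr. Qed.
Let p'V_gt1 : 1 < p'^-1. Proof. by rewrite p'V ltrDl oppr_gt0 invr_lt0. Qed.
Let p'_gt0 : 0 < p'. Proof. by rewrite -invr_gt0 (lt_trans _ p'V_gt1). Qed.
Let p'_lt1 : p' < 1. Proof. by rewrite -[p']invrK invf_lt1 ?invr_gt0. Qed.
Let p0 : p != 0. Proof. by rewrite lt_eqF. Qed.
Let q0 : q != 0. Proof. by rewrite lt_eqF. Qed.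
Let p'0 : p' != 0. Proof. by rewrite gt_eqF. Qed.
Let pp' : p * p' = p + p'.
Proof. by have := hp'; move: p0 p'0 => ? ? H; rewrite -[LHS]mulr1 -H; field; apply/andP. Qed.
Let w0 x : 0 <= w x. Proof. exact: powR_ge0. Qed.
Let mw : measurable_fun setT w. Proof. exact: measurable_fun_powR. Qed.

Local Notation U r := (\int[mu]_(y in N r) (u y)%:E)%E.
Local Notation W r := (\int[mu]_(y in N r) (w y)%:E)%E.

Let test (r t : R) (y : X) : R := if mdist a y < r then t else w y.

(** For a suitable constant on the ball, the function [test] makes the integral of [f^p v] at most
    [W r + e], where [e] bounds the part over the ball. *)
Let hardy_test (C r e : R) : 0 < C -> 0 < r -> 0 < e ->
  hardy_inequality mu a p q u v C -> (W r < +oo)%E ->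
  (C%:E * epow (W r + e%:E) p^-1 <= epow (epow (W r) q * U r) q^-1)%E.
Proof.
move=> C0 r0 e0 hC Woo.
have mB := borelMetric_measurable_ball a r; have mN := measurable_outer a r.
have WE : W r = (fine (W r))%:E.
  by rewrite fineK// ge0_fin_numE//; apply: integral_ge0 => x _; rewrite lee_fin.
pose V := fine (\int[mu]_(y in ball a r) (v y)%:E)%E.
have V0 : 0 <= V by apply: fine_ge0; apply: integral_ge0 => x _; rewrite lee_fin.
have VE : (\int[mu]_(y in ball a r) (v y)%:E = V%:E)%E.
  by rewrite fineK//; apply: integrable_fin_num => //; exact: hv.2.
pose t := (e / (V + 1)) `^ p^-1.
have t0 : 0 < t by apply: powR_gt0; rewrite divr_gt0// ltr_wpDl.
have tp : t `^ p * V <= e.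
  rewrite -powRrM mulVf// powRr1; last by rewrite divr_ge0 ?ltW// ltr_wpDl.
  by rewrite mulrAC ler_pdivrMr ?ltr_wpDl// ler_pM2l// lerDl.
have f0 y : 0 <= test r t y by rewrite /test; case: ifP => _; [exact: ltW|].
have mf : measurable_fun setT (test r t).
  apply: measurable_fun_ifT => //.
  by apply: measurable_fun_ltr => //; exact: measurable_mdist.
have mFq : measurable_fun setT
    (fun x => epow (\int[mu]_(y in N (mdist a x)) (test r t y)%:E)%E q).
  apply: measurable_fun_epow => //; last exact: measurable_integral_outer.
  by move=> x; apply: integral_ge0 => y _; rewrite lee_fin.
apply: le_trans (_ : C%:E * epow (\int[mu]_x (epow (test r t x)%:E p * (v x)%:E)) p^-1 <= _)%E.
  rewrite lee_pmul2l ?lte_fin// ?fin_numE//.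
  apply: le_epow; rewrite ?invr_lt0//.
    by apply: integral_ge0 => x _; rewrite mule_ge0 ?epow_ge0 ?lee_fin.
  rewrite -(setUv (ball a r)) ge0_integral_setU//; last 3 first.
  - rewrite setUv; apply: emeasurable_funM; last exact/measurable_EFinP.
    exact: measurable_fun_epow_EFin.
  - by move=> x _; rewrite mule_ge0 ?epow_ge0 ?lee_fin.
  - by rewrite disj_set2E setICr.
  rewrite addeC; apply: leeD.
    apply: ge0_le_integral => //.
    - by move=> x _; rewrite mule_ge0 ?epow_ge0 ?lee_fin.
    - apply: measurable_funTS; apply: emeasurable_funM; last exact/measurable_EFinP.
      exact: measurable_fun_epow_EFin.
    - by apply: measurable_funTS; exact/measurable_EFinP.
    move=> x; rewrite setC_ballE /= => rx; rewrite /test ltNge rx/=.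
    have := hv0 x; rewrite le_eqVlt => /orP[/eqP<-|v0].
      by rewrite mule0 lee_fin powR_ge0.
    rewrite epow_EFin ?powR_gt0// -EFinM lee_fin -powRrM.
    (* The exponents agree because [p * p' = p + p']. *)
    suff -> : v x `^ ((1 - p') * p) * v x = w x by [].
    rewrite -[X in _ * X]powRr1; last exact: ltW.
    rewrite -powRD; last by rewrite (gt_eqF v0) implybT.
    by congr (_ `^ _); rewrite mulrBl mul1r [p' * p]mulrC pp'; ring.
  rewrite (eq_integral (fun x => (t `^ p)%:E * (v x)%:E)%E); last first.
    move=> x; rewrite inE ballEmdist/= => xr; rewrite /test xr.
    by rewrite epow_EFin.
  rewrite ge0_integralZl//.
  - by rewrite VE lee_fin.
  - by apply: measurable_funTS; exact/measurable_EFinP.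
  - by move=> x _; rewrite lee_fin.
  - by rewrite lee_fin powR_ge0.
apply: le_trans (hC _ mf f0) _.
apply: le_epow; rewrite ?invr_lt0//.
  by rewrite mule_ge0 ?epow_ge0//; apply: integral_ge0 => x _; rewrite lee_fin.
rewrite -ge0_integralZl//; last 3 first.
- exact/measurable_EFinP/measurable_funTS.
- by move=> x _; rewrite lee_fin.
- exact: epow_ge0.
(* For [x] outside the ball the inner integral of [test] is at most [W r], and the power [q < 0]
   reverses this; the part of the outer integral over the ball is dropped. *)
apply: (@le_trans _ _ (\int[mu]_(x in N r)
    (epow (\int[mu]_(y in N (mdist a x)) (test r t y)%:E) q * (u x)%:E)))%E.
  apply: ge0_le_integral => //.
  - by move=> x _; rewrite mule_ge0 ?epow_ge0 ?lee_fin.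
  - by apply: measurable_funeM; exact/measurable_EFinP/measurable_funTS.
  - apply/measurable_funTS/emeasurable_funM; last exact/measurable_EFinP.
    exact: mFq.
  move=> x Nx; have rx : r <= mdist a x by move: Nx; rewrite setC_ballE.
  rewrite lee_wpmul2r ?lee_fin//.
  apply: le_epow => //; first by apply: integral_ge0 => y _; rewrite lee_fin.
  rewrite (eq_integral (EFin \o w)); last first.
    move=> y; rewrite inE setC_ballE/= => xy.
    by rewrite /test ltNge (le_trans rx xy).
  apply: ge0_subset_integral => //; first exact: measurable_outer.
  - exact/measurable_EFinP/measurable_funTS.
  - by move=> y _; rewrite lee_fin.
  - exact: subset_outer.
apply: ge0_subset_integral => //.
- apply/emeasurable_funM; last exact/measurable_EFinP.
  exact: mFq.
- by move=> x _; rewrite mule_ge0 ?epow_ge0 ?lee_fin.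
Qed.

(** Letting [e] tend to 0 in [hardy_test] gives [C * B^(1/p) <= B * A^(1/q)]; dividing by [B^(1/p)]
    leaves [B^(1/p')] on the right. For [B = +oo] or [A = 0] the characteristic function is
    [+oo]. *)
Lemma hardy_le_char (C : R) (x : X) : 0 < C -> x != a ->
  hardy_inequality mu a p q u v C ->
  (C%:E <= hardy_char mu a q p' u v (mdist a x))%E.
Proof.
move=> C0 xa hC; set r := mdist a x.
have r0 : 0 < r by rewrite mdist_gt0 eq_sym.
rewrite /hardy_char; set A := U r; set B := W r.
have A0 : (0 <= A)%E by apply: integral_ge0 => y _; rewrite lee_fin.
have B0 : (0 <= B)%E by apply: integral_ge0 => y _; rewrite lee_fin.
have p'V0 : 0 < p'^-1 by rewrite invr_gt0.
have [Boo|Boo] := eqVneq B +oo%E.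
  by rewrite Boo [epow +oo p'^-1]epow_gt0E// poweRyr ?gt_eqF// upper_mulexy ?epow_ge0// leey.
have [A00|A00] := eqVneq A 0%E.
  by rewrite A00 epow0r ?invr_lt0// upper_muleyx ?epow_ge0// leey.
have Blty : (B < +oo)%E by rewrite ltey.
have Apos : (0 < A)%E by rewrite lt0e A00.
have key e : 0 < e ->
    (C%:E * epow (B + e%:E) p^-1 <= epow (epow B q * A) q^-1)%E.
  by move=> e0; exact: hardy_test.
have BE : B = (fine B)%:E by rewrite fineK// ge0_fin_numE.
set b := fine B in BE; have b0 : 0 <= b by exact: fine_ge0.
(* The right side of [key] would be 0 while its left side is positive. This excludes [B = 0] and
   [A = +oo]. *)
have contra : (epow B q * A = +oo)%E -> False.
  move=> BAoo; have := key 1 ltr01; rewrite BAoo epowyr ?invr_lt0//.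
  rewrite BE -EFinD epow_EFin ?ltr_wpDl// -EFinM lee_fin leNgt.
  by rewrite mulr_gt0// powR_gt0// ltr_wpDl.
have {}b0 : 0 < b.
  rewrite lt_neqAle b0 andbT; apply/eqP => b00; apply: contra.
  by rewrite BE -b00 epow0r// gt0_mulye.
have Alty : (A < +oo)%E.
  rewrite ltey; apply/eqP => Aoo; apply: contra.
  by rewrite Aoo BE epow_EFin// gt0_muley// lte_fin powR_gt0.
have AE : A = (fine A)%:E by rewrite fineK// ge0_fin_numE.
set al := fine A in AE; have al0 : 0 < al by rewrite fine_gt0// Apos.
rewrite BE AE !epow_EFin// upper_mule_fin ?ltry// -EFinM lee_fin.
pose M := b * al `^ q^-1; have M0 : 0 < M by rewrite mulr_gt0 ?powR_gt0.
have {}key e : 0 < e -> C * (b + e) `^ p^-1 <= M.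
  move=> e0; have be0 : 0 < b + e by exact: addr_gt0.
  have := key e e0; rewrite BE AE -EFinD epow_EFin// [epow b%:E q]epow_EFin//.
  rewrite -!EFinM epow_EFin ?mulr_gt0 ?powR_gt0// lee_fin.
  rewrite powRM; [|exact: powR_ge0|exact: ltW].
  by rewrite -[(b `^ q) `^ _]powRrM divff// powRr1//; exact: ltW.
(* Solving for [b + e] makes the limit in [e] a statement about sums, with no continuity of powers
   involved. *)
have Mb : (M / C) `^ p <= b.
  apply/ler_addgt0Pr => e e0; have be0 : 0 < b + e by exact: addr_gt0.
  rewrite -[leRHS](@powR_cancel _ _ p)//; last exact: ltW.
  apply: le_powR_neg; rewrite ?powR_gt0//.
  by rewrite ler_pdivlMr// mulrC key.
have {}Mb : b `^ p^-1 <= M / C.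
  rewrite -[leRHS](@powR_cancel _ _ p^-1) ?invrK ?invr_eq0//; last first.
    by rewrite divr_ge0 ?ltW.
  by apply: le_powR_neg; rewrite ?invr_lt0// powR_gt0// divr_gt0.
have {}Mb : C * b `^ p^-1 <= M by rewrite [leLHS]mulrC -ler_pdivlMr.
have -> : al `^ q^-1 * b `^ p'^-1 = M / b `^ p^-1.
  rewrite p'V powRD; last by rewrite (gt_eqF b0) implybT.
  rewrite powRr1; last exact: ltW.
  by rewrite powRN /M; ring.
by rewrite ler_pdivlMr// powR_gt0.
Qed.

Local Notation Ur x := (fine (U (mdist a x))).
Local Notation Wr x := (fine (W (mdist a x))).

Lemma reverse_holder (D : set X) (f V : X -> R) : measurable D ->
  measurable_fun setT f -> measurable_fun setT V ->
  (forall x, 0 <= f x) -> (forall x, 0 <= V x) ->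
  {ae mu, forall x, f x = 0 -> V x = 0} ->
  (\int[mu]_(x in D) (V x `^ (1 - p'))%:E <=
   (\int[mu]_(x in D) (f x)%:E) `^ p' *
   (\int[mu]_(x in D) (f x `^ p * V x)%:E) `^ (1 - p'))%E.
Proof.
move=> mD mf mV f0 V0 fV.
have mg : measurable_fun setT (fun x => f x `^ p * V x).
  by apply: measurable_funM => //; exact: measurable_fun_powR.
apply: le_trans (ge0_integral_powR_holder mu _ mD mf mg f0 _); last 2 first.
- by rewrite p'_gt0 ltW.
- by move=> x; rewrite mulr_ge0 ?powR_ge0.
apply: ae_ge0_le_integral => //.
- by move=> x _; rewrite lee_fin powR_ge0.
- by apply/measurable_funTS/measurable_EFinP/measurable_fun_powR.
- by move=> x _; rewrite lee_fin mulr_ge0 ?powR_ge0.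
- apply/measurable_funTS/measurable_EFinP/measurable_funM;
    exact: measurable_fun_powR.
apply: filterS fV => x fVx _; rewrite lee_fin.
have [fx0|fx0] := eqVneq (f x) 0.
  by rewrite fVx// powR0 ?mulr_ge0 ?powR_ge0// subr_eq0 gt_eqF.
rewrite powRM ?powR_ge0// mulrA -powRrM -powRD ?fx0 ?implybT//.
rewrite (_ : p' + _ = 0) ?powRr0 ?mul1r//.
by rewrite mulrBr pp'; ring.
Qed.

(** * Sufficiency *)

Section sufficiency.
Hypothesis sphere0 : forall r, (\int[mu]_(x in msphere a r) (u x)%:E = 0)%E.
Hypothesis char_ni : hardy_char_nonincreasing mu a q p' u v.
Variable C : R.
Hypothesis C0 : 0 < C.
Hypothesis C_le : forall x, x != a ->
  (C%:E <= hardy_char mu a q p' u v (mdist a x))%E.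

(* Off [Z] the left integrand vanishes almost everywhere: either [U = 0], or the
   integral of [f] over [N |x|] is infinite by the reverse Hoelder inequality. *)
Let Z := [set x | [/\ x != a, (0 < U (mdist a x))%E & (W (mdist a x) < +oo)%E]].

Let U0 r : (0 <= U r)%E.
Proof. by apply: integral_ge0 => y _; rewrite lee_fin. Qed.

Let W0 r : (0 <= W r)%E.
Proof. by apply: integral_ge0 => y _; rewrite lee_fin. Qed.

Let Ur0 x : 0 <= Ur x. Proof. exact: fine_ge0. Qed.

(** With [W] finite, either [U = +oo] or [W = 0] would make the characteristic function 0, below
    [C]. *)
Let charE x : Z x ->
  [/\ 0 < Ur x, 0 < Wr x, (U (mdist a x) < +oo)%E,
      hardy_char mu a q p' u v (mdist a x) =
        (Ur x `^ q^-1 * Wr x `^ p'^-1)%:E &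
      C <= Ur x `^ q^-1 * Wr x `^ p'^-1].
Proof.
move=> [xa Upos Wlty]; have := C_le xa; rewrite /hardy_char.
have WE : W (mdist a x) = (Wr x)%:E by rewrite fineK// ge0_fin_numE.
have p'V0 : 0 < p'^-1 by rewrite invr_gt0.
have eW : epow (W (mdist a x)) p'^-1 = (Wr x `^ p'^-1)%:E.
  by rewrite epow_gt0E// WE.
have [Uoo|Ulty] := eqVneq (U (mdist a x)) +oo%E.
  rewrite Uoo epowyr ?invr_lt0// eW upper_mule_fin ?ltry// mul0e.
  by rewrite lee_fin leNgt C0.
have {}Ulty : (U (mdist a x) < +oo)%E by rewrite ltey.
have UE : U (mdist a x) = (Ur x)%:E by rewrite fineK// ge0_fin_numE.
have Urpos : 0 < Ur x by rewrite fine_gt0// Upos.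
have eU : epow (U (mdist a x)) q^-1 = (Ur x `^ q^-1)%:E.
  by rewrite -(epow_EFin _ Urpos) -UE.
rewrite eU eW upper_mule_fin ?ltry// -EFinM lee_fin => Cle; split => //.
rewrite lt_neqAle fine_ge0// andbT; apply/eqP => Wr0; move: Cle.
by rewrite -Wr0 powR0 ?mulr0 ?leNgt ?C0// gt_eqF.
Qed.

(** The set [Z] is closed under moving outwards: if [U] vanished at the larger radius, the
    characteristic function would be [+oo] there, against its monotonicity and its finite value at
    [x]. *)
Let Z_up x y : Z x -> mdist a x <= mdist a y ->
  Z y /\ Ur y `^ q^-1 * Wr y `^ p'^-1 <= Ur x `^ q^-1 * Wr x `^ p'^-1.
Proof.
move=> Zx xy; have [Ux Wx Uoo cx Cx] := charE Zx.
have [xa _ Wlty] := Zx.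
have x0 : 0 < mdist a x by rewrite mdist_gt0 eq_sym.
have ya : y != a by rewrite eq_sym -mdist_gt0 (lt_le_trans x0).
have := char_ni xa ya xy.
have Zy : (0 < U (mdist a y))%E -> Z y.
  move=> Uy; split => //; apply: le_lt_trans Wlty.
  exact: (le_outer a (density mu mw w0) xy).
have [Uy0|Uy0] := eqVneq (U (mdist a y)) 0%E.
  have -> : hardy_char mu a q p' u v (mdist a y) = +oo%E.
    by rewrite /hardy_char Uy0 epow0r ?invr_lt0// upper_muleyx// epow_ge0.
  by rewrite cx leye_eq.
have {}Zy : Z y by apply: Zy; rewrite lt0e Uy0 U0.
by have [_ _ _ -> _] := charE Zy; rewrite cx lee_fin.
Qed.

(** Equality holds when [D] is the product itself, because [1 - p' = - (p' / p)]; a larger [D]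
    lowers the left side, as [p' / p < 0]. *)
Let weight_ge (D uy wy : R) : 0 < uy -> 0 < wy ->
  uy `^ q^-1 * wy `^ p'^-1 <= D ->
  D `^ (p' / p) * wy `^ (- p^-1) <= (uy `^ (- q^-1)) `^ (1 - p').
Proof.
move=> uy0 wy0 le_D.
have E0 : 0 < uy `^ q^-1 * wy `^ p'^-1 by rewrite mulr_gt0 ?powR_gt0.
have pp'0 : p' / p < 0 by rewrite pmulr_rlt0 ?invr_lt0.
apply: (@le_trans _ _ ((uy `^ q^-1 * wy `^ p'^-1) `^ (p' / p) * wy `^ (- p^-1))).
  by rewrite ler_pM2r ?powR_gt0// le_powR_neg.
have [lu ->] := gt0_expR uy0; have [lw ->] := gt0_expR wy0.
rewrite !powR_expR -expRD powR_expR -expRD le_eqVlt; apply/orP; left.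
apply/eqP; congr expR.
have -> : 1 - p' = - (p' / p).
  apply: (mulfI p0); rewrite mulrBr pp' mulr1 mulrN mulrCA divff// mulr1.
  by rewrite opprD addrA subrr add0r.
by field; apply/and3P.
Qed.

(** The last hypothesis is raised to the negative power [q / p'], [w1] is eliminated through [D],
    and [D]^ q[is bounded by]C [^ q]. Its left side is positive, so no factor on its right side
    vanishes. *)
Let pointwise_real (b D u0 w1 k a1 F : R) : 0 < b -> 0 < u0 -> 0 < w1 -> 0 <= k ->
  0 <= a1 -> 0 <= F ->
  D = u0 `^ q^-1 * w1 `^ p'^-1 -> C <= D ->
  D `^ (p' / p) * (w1 `^ p'^-1 * b) <=
    F `^ p' * (k `^ (p / q) * a1) `^ (1 - p') ->
  0 < F /\
  F `^ q <= b `^ (q / p') * C `^ q * a1 `^ (q / p) * u0 `^ (- p'^-1) * k.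
Proof.
move=> b0 u00 w10 k0 a10 F0 DE CD le_F.
have D0 : 0 < D by rewrite (lt_le_trans C0).
have L0 : 0 < F `^ p' * (k `^ (p / q) * a1) `^ (1 - p').
  by rewrite (lt_le_trans _ le_F)// !mulr_gt0 ?powR_gt0.
have pq0 : p / q != 0 by rewrite mulf_neq0 ?invr_eq0.
have onep' : 1 - p' != 0 by rewrite subr_eq0 gt_eqF.
have {}F0 : 0 < F.
  rewrite lt_neqAle F0 andbT; apply/eqP => Fe; move: L0.
  by rewrite -Fe powR0// mul0r ltxx.
have {}k0 : 0 < k.
  rewrite lt_neqAle k0 andbT; apply/eqP => ke; move: L0.
  by rewrite -ke [0 `^ (p / q)]powR0// mul0r [0 `^ (1 - p')]powR0// mulr0 ltxx.
have {}a10 : 0 < a1.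
  rewrite lt_neqAle a10 andbT; apply/eqP => ae; move: L0.
  by rewrite -ae mulr0 [0 `^ (1 - p')]powR0// mulr0 ltxx.
split => //.
have qp' : q / p' < 0 by rewrite pmulr_llt0 ?invr_gt0.
apply: (@le_trans _ _
   (b `^ (q / p') * D `^ q * a1 `^ (q / p) * u0 `^ (- p'^-1) * k)); last first.
  rewrite ler_pM2r// ler_pM2r ?powR_gt0// ler_pM2r ?powR_gt0//.
  by rewrite ler_pM2l ?powR_gt0// le_powR_neg.
have P0 : 0 < D `^ (p' / p) * (w1 `^ p'^-1 * b) by rewrite !mulr_gt0 ?powR_gt0.
have := le_powR_neg qp' P0 le_F; rewrite DE.
have [lu ->] := gt0_expR u00; have [lw ->] := gt0_expR w10.
have [lb ->] := gt0_expR b0.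
have [lk ->] := gt0_expR k0; have [la ->] := gt0_expR a10.
have [lF ->] := gt0_expR F0.
do ![rewrite powR_expR | rewrite -expRD].
rewrite !ler_expR -subr_ge0 => H; rewrite -subr_ge0.
apply: le_trans H _; rewrite le_eqVlt; apply/orP; left; apply/eqP.
have p10 : p - 1 != 0 by rewrite lt_eqF// subr_lt0 (lt_trans hp).
have -> : p' = p / (p - 1).
  by apply: (mulIf p10); rewrite divfK// mulrBr mulr1 mulrC pp' addrK.
by field; apply/and3P.
Qed.

Let mUr : measurable_fun setT (fun x => Ur x).
Proof.
apply: (measurableT_comp (fine_measurable measurableT)).
exact: measurable_integral_outer.
Qed.

Let mWr : measurable_fun setT (fun x => Wr x).
Proof.
apply: (measurableT_comp (fine_measurable measurableT)).
exact: measurable_integral_outer.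
Qed.

Let weighted_tail x : Z x ->
  (((Ur x `^ q^-1 * Wr x `^ p'^-1) `^ (p' / p) * (Wr x `^ p'^-1 * p'))%:E <=
   \int[mu]_(y in N (mdist a x)) ((v y * Ur y `^ (- q^-1)) `^ (1 - p'))%:E)%E.
Proof.
move=> Zx; have [ux wx Uoo cx Cx] := charE Zx; have [_ _ Woo] := Zx.
pose D := Ur x `^ q^-1 * Wr x `^ p'^-1; rewrite -/D; have mN := measurable_outer a (mdist a x).
have mp0 : 0 < - p^-1 by rewrite oppr_gt0 invr_lt0.
have := integral_tail_powR_ge (nu := density mu mw w0) mp0 Woo.
have -> : - p^-1 + 1 = p'^-1 by rewrite p'V addrC.
rewrite invrK ge0_integral_density//; last first.
  by apply/measurable_funTS/measurable_EFinP/measurable_fun_powR.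
move=> L1.
apply: (@le_trans _ _ (\int[mu]_(y in N (mdist a x))
    ((D `^ (p' / p))%:E * ((Wr y `^ (- p^-1))%:E * (w y)%:E)))%E).
  rewrite ge0_integralZl//; last 3 first.
  - apply: emeasurable_funM; last exact/measurable_funTS/measurable_EFinP.
    by apply/measurable_funTS/measurable_EFinP/measurable_fun_powR.
  - by move=> y _; rewrite mule_ge0 ?lee_fin ?powR_ge0.
  - by rewrite lee_fin powR_ge0.
  by rewrite EFinM; apply: lee_wpmul2l => //; rewrite lee_fin powR_ge0.
apply: ge0_le_integral => //.
- by move=> y _; rewrite !mule_ge0 ?lee_fin ?powR_ge0.
- apply/measurable_funTS/measurable_funeM/emeasurable_funM.
    by apply/measurable_EFinP/measurable_fun_powR.
  exact/measurable_EFinP.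
- apply/measurable_funTS/measurable_EFinP/measurable_fun_powR/measurable_funM => //.
  exact: measurable_fun_powR.
move=> y Ny; have xy : mdist a x <= mdist a y by move: Ny; rewrite setC_ballE.
have [Zy Dy] := Z_up Zx xy; have [uy wy _ _ _] := charE Zy.
rewrite -!EFinM lee_fin powRM; [|exact: hv0|exact: powR_ge0].
rewrite mulrA [leRHS]mulrC.
by apply: ler_wpM2r; [exact: powR_ge0|exact: weight_ge].
Qed.

Section test_function.
Variable f : X -> R.
Hypotheses (mf : measurable_fun setT f) (f0 : forall x, 0 <= f x).
Hypothesis fv : {ae mu, forall x, f x = 0 -> v x = 0}.

(** By [fv] this real version agrees almost everywhere with the extended [f^p v]: at zeros of [f]
    both are 0. *)
Let g x := f x `^ p * v x.
Hypothesis goo : (\int[mu]_x (g x)%:E < +oo)%E.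

Let F x := (\int[mu]_(y in N (mdist a x)) (f y)%:E)%E.
Let A := fine (\int[mu]_x (g x)%:E)%E.
Let K x := (\int[mu]_(y in N (mdist a x)) (g y * Ur y `^ (- p^-1))%:E)%E.

Let g0 x : 0 <= g x. Proof. by rewrite mulr_ge0 ?powR_ge0. Qed.

Let mg : measurable_fun setT g.
Proof. by apply: measurable_funM => //; exact: measurable_fun_powR. Qed.

Let AE : (\int[mu]_x (g x)%:E = A%:E)%E.
Proof.
rewrite fineK// ge0_fin_numE//.
by apply: integral_ge0 => x _; rewrite lee_fin.
Qed.

Let le_gA r : (\int[mu]_(x in N r) (g x)%:E <= A%:E)%E.
Proof.
rewrite -AE; apply: ge0_subset_integral => //.
- exact: measurable_outer.
- exact/measurable_EFinP.
- by move=> x _; rewrite lee_fin.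
Qed.

Let mgU c : measurable_fun setT (fun x => g x * Ur x `^ c).
Proof. by apply: measurable_funM => //; exact: measurable_fun_powR. Qed.

Let gU0 c x : 0 <= g x * Ur x `^ c.
Proof. by rewrite mulr_ge0 ?powR_ge0. Qed.

Let K0 x : (0 <= K x)%E.
Proof. by apply: integral_ge0 => y _; rewrite lee_fin. Qed.

Let Klty x : Z x -> (K x < +oo)%E.
Proof.
move=> Zx; have [ux wx Uoo cx Cx] := charE Zx.
have mN := measurable_outer a (mdist a x).
apply: (@le_lt_trans _ _ ((Ur x `^ (- p^-1))%:E * A%:E)%E).
  apply: (@le_trans _ _ ((Ur x `^ (- p^-1))%:E *
     \int[mu]_(y in N (mdist a x)) (g y)%:E)%E); last first.
    by rewrite lee_wpmul2l ?lee_fin ?powR_ge0.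
  rewrite -ge0_integralZl//; last 3 first.
  - exact/measurable_funTS/measurable_EFinP.
  - by move=> y _; rewrite lee_fin.
  - by rewrite lee_fin powR_ge0.
  apply: ge0_le_integral; first exact: mN.
  - by move=> y _; rewrite lee_fin; exact: gU0.
  - exact/measurable_funTS/measurable_EFinP.
  - exact/measurable_funTS/measurable_funeM/measurable_EFinP.
  move=> y Ny; have xy : mdist a x <= mdist a y by move: Ny; rewrite setC_ballE.
  rewrite -EFinM lee_fin [leRHS]mulrC; apply: ler_wpM2l; first exact: g0.
  apply: ge0_ler_powR; rewrite ?nnegrE; [|exact: Ur0|exact: Ur0|].
    by rewrite oppr_ge0 invr_le0 ltW.
  apply: fine_le; rewrite ?ge0_fin_numE//.
    by apply: le_lt_trans Uoo; exact: (le_outer a (density mu mu_ hu0) xy).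
  exact: (le_outer a (density mu mu_ hu0) xy).
by rewrite -EFinM ltry.
Qed.

Let s : R := p / q.
Let s01 : 0 < s <= 1.
Proof.
rewrite /s nmulr_lgt0 ?invr_lt0// hp/= ler_ndivrMr// mul1r.
exact: hqp.
Qed.

Let pointwise x : Z x ->
  (epow (F x) q <=
   (p' `^ (q / p') * C `^ q * (A `^ (1 - s)) `^ (q / p) *
     Ur x `^ (- p'^-1))%:E * K x)%E.
Proof.
move=> Zx; have [ux wx Uoo cx Cx] := charE Zx.
have mN := measurable_outer a (mdist a x).
have KE : K x = (fine (K x))%:E by rewrite fineK// ge0_fin_numE// Klty.
have k0 : 0 <= fine (K x) by exact: fine_ge0.
have A0 : 0 <= A by apply: fine_ge0; apply: integral_ge0 => y _; rewrite lee_fin.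
have F0 : (0 <= F x)%E by apply: integral_ge0 => y _; rewrite lee_fin.
have onep' : 0 <= 1 - p' by rewrite subr_ge0 ltW.
have ones : 0 <= 1 - s by rewrite subr_ge0; case/andP: s01.
have ci (t : \bar R) : (0 <= t)%E -> t \in `[0%E, +oo%E].
  by move=> t0; rewrite in_itv/= t0 leey.
(* Jensen's inequality for the measure [g mu] *)
have H1 : (\int[mu]_(y in N (mdist a x)) (g y * Ur y `^ (- q^-1))%:E <=
    (fine (K x) `^ s * A `^ (1 - s))%:E)%E.
  apply: (@le_trans _ _ (\int[mu]_(y in N (mdist a x))
      ((g y * Ur y `^ (- p^-1)) `^ s * g y `^ (1 - s))%:E)%E).
    apply: ge0_le_integral; first exact: mN.
    - by move=> y _; rewrite lee_fin; exact: gU0.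
    - exact/measurable_funTS/measurable_EFinP.
    - apply/measurable_funTS/measurable_EFinP/measurable_funM;
        exact: measurable_fun_powR.
    move=> y _; rewrite lee_fin powRM; [|exact: g0|exact: powR_ge0].
    rewrite -powRrM mulNr /s mulrA mulVf// mul1r [leRHS]mulrAC -powRD; last first.
      by rewrite subrKC oner_eq0.
    by rewrite subrKC powRr1; [exact: lexx|exact: g0].
  apply: le_trans (ge0_integral_powR_holder mu s01 mN (mgU _) mg (gU0 _) g0) _.
  rewrite -/(K x) KE EFinM -!poweR_EFin.
  apply: lee_wpmul2l; first exact: poweR_ge0.
  apply: gt0_ler_poweR; [exact: ones|apply: ci|apply: ci|exact: le_gA].
    by apply: integral_ge0 => y _; rewrite lee_fin; exact: g0.
  by rewrite lee_fin.
have := weighted_tail Zx.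
have fvU : {ae mu, forall x, f x = 0 -> v x * Ur x `^ (- q^-1) = 0}.
  by apply: filterS fv => y fvy /fvy ->; rewrite mul0r.
have mvU : measurable_fun setT (fun x => v x * Ur x `^ (- q^-1)).
  by apply: measurable_funM => //; exact: measurable_fun_powR.
have vU0 y : 0 <= v y * Ur y `^ (- q^-1) by rewrite mulr_ge0 ?powR_ge0.
move=> /le_trans/(_ (reverse_holder mN mf mvU f0 vU0 fvU)).
under [X in (_ <= _ * X `^ _)%E -> _]eq_integral do rewrite mulrA.
rewrite -/(F x) => H2.
have [Foo|Foo] := eqVneq (F x) +oo%E.
  rewrite Foo epowyr; last exact: hq.
  apply: mule_ge0; last exact: K0.
  by rewrite lee_fin; do !apply: mulr_ge0; exact: powR_ge0.
have FE : F x = (fine (F x))%:E by rewrite fineK// ge0_fin_numE// ltey.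
have Fr0 : 0 <= fine (F x) by exact: fine_ge0.
have H3 : (Ur x `^ q^-1 * Wr x `^ p'^-1) `^ (p' / p) * (Wr x `^ p'^-1 * p') <=
    fine (F x) `^ p' * (fine (K x) `^ s * A `^ (1 - s)) `^ (1 - p').
  rewrite -lee_fin; apply: le_trans H2 _.
  rewrite {1}FE EFinM -!poweR_EFin lee_wpmul2l ?poweR_ge0//.
  apply: gt0_ler_poweR; [exact: onep'| apply: ci|apply: ci|exact: H1].
    by apply: integral_ge0 => y _; rewrite lee_fin; exact: (gU0 (- q^-1) y).
  by rewrite lee_fin mulr_ge0 ?powR_ge0.
have [Fpos Fle] := pointwise_real p'_gt0 ux wx k0 (powR_ge0 _ _) Fr0 erefl Cx H3.
by rewrite FE epow_EFin// KE -EFinM lee_fin.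
Qed.

Let mZ : measurable Z.
Proof.
have mU := measurable_integral_outer mu a mu_ hu0.
have mW := measurable_integral_outer mu a mw w0.
rewrite (_ : Z = [set x | 0 < mdist a x] `&`
    ([set x | (0 < U (mdist a x))%E] `&` [set x | (W (mdist a x) < +oo)%E])).
  apply: measurableI.
    have := measurable_fun_ltr (measurable_cst (0 : R)) (measurable_mdist a).
    by move=> /(_ measurableT [set true] I); rewrite setTI.
  apply: measurableI; rewrite -[X in measurable X]setTI.
    exact: emeasurable_fun_o_infty.
  exact: emeasurable_fun_infty_o.
apply/seteqP; split => x; rewrite /Z/= mdist_gt0 eq_sym; first by case.
by case=> ? [].
Qed.

Let nuU := density mu mu_ hu0.
Let beta := density mu mg g0.
Let kappa := p' `^ (q / p') * C `^ q * (A `^ (1 - s)) `^ (q / p).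
(** The coefficient of [K x] in [pointwise], set to 0 off [Z] so that the bound can be integrated
    over the whole space. *)
Let cx x : R := \1_Z x * (kappa * Ur x `^ (- p'^-1)).

Let kappa0 : 0 <= kappa.
Proof. by do !apply: mulr_ge0; exact: powR_ge0. Qed.

Let cx0 x : 0 <= cx x.
Proof.
apply: mulr_ge0; first exact: indic_ge0.
by apply: mulr_ge0; [exact: kappa0|exact: powR_ge0].
Qed.

Let mcx : measurable_fun setT cx.
Proof.
apply: measurable_funM; first exact: measurable_indic.
by apply: measurable_funM => //; exact: measurable_fun_powR.
Qed.

Let nuU_lty r : (nuU (ball a r) < +oo)%E.
Proof.
have /integrableP[_] := hu.2 a r.
by under eq_integral do rewrite /= ger0_norm//.
Qed.

Let sigma_finite_nuU : sigma_finite setT nuU.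
Proof.
exists (fun n => ball a n%:R); last first.
  by move=> n; split; [exact: borelMetric_measurable_ball|exact: nuU_lty].
apply/seteqP; split => // x _; exists (Num.bound (mdist a x)) => //.
by rewrite ballEmdist/= archi_boundP// mdist_ge0.
Qed.

Let sigma_finite_beta : sigma_finite setT beta.
Proof. by exists (fun=> setT); rewrite ?bigcup_const. Qed.

Let k0 y : 0 <= Ur y `^ (- p^-1). Proof. exact: powR_ge0. Qed.

Let mk : measurable_fun setT (fun y => Ur y `^ (- p^-1)).
Proof. exact: measurable_fun_powR. Qed.

Let KE x :
  K x = (\int[beta]_(y in N (mdist a x)) (Ur y `^ (- p^-1))%:E)%E.
Proof.
have mN := measurable_outer a (mdist a x).
rewrite ge0_integral_density; [|exact: mN| |]; last 2 first.
- by apply/measurable_funTS/measurable_EFinP; exact: mk.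
- by move=> y _; rewrite lee_fin; exact: k0.
by apply: eq_integral => y _; rewrite -EFinM mulrC.
Qed.

Let tail_le y :
  ((Ur y `^ (- p^-1))%:E *
    \int[nuU]_(x in [set x | (mdist a x <= mdist a y)%R]) (cx x)%:E <=
   (kappa * `|p|)%:E)%E.
Proof.
have mD : measurable [set x | mdist a x <= mdist a y].
  have := measurable_fun_ler (measurable_mdist a) (measurable_cst (mdist a y)).
  by move=> /(_ measurableT [set true] I); rewrite setTI.
have cxE x : (cx x)%:E =
    (kappa%:E * ((fun x => (Ur x `^ (- p'^-1))%:E) \_ Z) x)%E.
  by rewrite epatch_indic -!EFinM /cx mulrC -mulrA.
rewrite (eq_integral _ _ (fun x _ => cxE x)).
rewrite ge0_integralZl; last 4 first.
- exact: mD.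
- apply/measurable_funTS/(measurable_restrictT _ mZ).
  by apply/measurable_funTS/measurable_EFinP; exact: measurable_fun_powR.
- by move=> x _; apply: erestrict_ge0 => z _; rewrite lee_fin; exact: powR_ge0.
- by rewrite lee_fin; exact: kappa0.
rewrite -integral_mkcondr setIC [leRHS]EFinM muleCA.
apply: lee_wpmul2l; first by rewrite lee_fin; exact: kappa0.
(* A point of [Z] in the closed ball puts [y] in [Z], so that [Ur y] is positive and finite; without
   such a point the integral is 0. *)
have [D0|/set0P[x [Zx xy]]] :=
    eqVneq (Z `&` [set x | mdist a x <= mdist a y]) set0.
  by rewrite D0 integral_set0 mule0 lee_fin.
have [Zy _] := Z_up Zx xy; have [uy _ Uoo _ _] := charE Zy.
have UE : nuU (N (mdist a y)) = (Ur y)%:E by rewrite fineK// ge0_fin_numE.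
have ZU z : Z z -> (nuU (N (mdist a z)) < +oo)%E.
  by move=> Zz; have [_ _ ? _ _] := charE Zz.
have sub : [set x | mdist a x <= mdist a y] `<=` ball a (mdist a y + 1).
  by rewrite ballEmdist => z /= /le_lt_trans; apply; rewrite ltrDl.
have Boo : (nuU [set x | (mdist a x <= mdist a y)%R] < +oo)%E.
  apply: le_lt_trans (nuU_lty (mdist a y + 1)).
  by apply: le_measure; rewrite ?inE//; exact: borelMetric_measurable_ball.
have Upos : (0 < nuU (N (mdist a y)) < +oo)%E by rewrite UE lte_fin uy ltry.
have S0 : nuU (msphere a (mdist a y)) = 0%E := sphere0 _.
have := integral_tail_powR_le p'V_gt1 mZ S0 Boo Upos ZU.
have -> : 1 - p'^-1 = p^-1 by rewrite p'V; ring.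
have -> : p'^-1 - 1 = - p^-1 by rewrite p'V; ring.
move=> L2; apply: le_trans (lee_wpmul2l _ L2) _; first by rewrite lee_fin.
rewrite -EFinM lee_fin mulrA -powRD; last by rewrite (gt_eqF uy) implybT.
by rewrite addNr powRr0 mul1r invrN invrK ltr0_norm.
Qed.

Lemma integral_outer_le :
  (\int[mu]_x (epow (F x) q * (u x)%:E) <= (kappa * `|p| * A)%:E)%E.
Proof.
have mF : measurable_fun setT F by exact: measurable_integral_outer.
have F0 x : (0 <= F x)%E.
  by apply: integral_ge0 => y _; rewrite lee_fin.
rewrite -(@ge0_integral_densityT _ _ _ mu u mu_ hu0 (fun x => epow (F x) q)); last 2 first.
- by apply: measurable_fun_epow.
- by move=> x; exact: epow_ge0.
have mK : measurable_fun setT K.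
  by apply: measurable_integral_outer; [exact: mgU|exact: gU0].
apply: (@le_trans _ _ (\int[nuU]_x ((cx x)%:E * K x))%E).
  apply: ae_ge0_le_integral.
  - exact: measurableT.
  - by move=> x _; exact: epow_ge0.
  - by apply: measurable_fun_epow.
  - by move=> x _; apply: mule_ge0; [rewrite lee_fin; exact: cx0|exact: K0].
  - by apply: emeasurable_funM => //; exact/measurable_EFinP.
  have mE1 := measurable_msphere a 0.
  have mE2 : measurable [set x | (nuU (N (mdist a x)) <= 0)%E].
    rewrite -[X in measurable X]setTI; apply: emeasurable_fun_infty_c => //.
    exact: measurable_nu_outer.
  (* The exceptional set is the center together with the points of zero tail. The first is a null
     sphere; the second is null by [measure_le_outer] with bound 0. *)
  exists (msphere a 0 `|` [set x | (nuU (N (mdist a x)) <= 0)%E]); split.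
  - exact: measurableU.
  - apply/eqP; rewrite -measure_le0.
    apply: le_trans (measureU2 nuU mE1 mE2) _.
    rewrite -[leRHS]adde0; apply: leeD.
      by rewrite le_eqVlt; apply/orP; left; apply/eqP; exact: sphere0.
    by apply: (measure_le_outer (a := a) mE2) => // x; exact.
  move=> x /=; apply: contra_notP => /not_orP[xa Ux] _.
  have {}xa : x != a.
    by apply/eqP => e; apply: xa; rewrite e /msphere/= mdistxx.
  have {}Ux : (0 < U (mdist a x))%E by rewrite ltNge; apply/negP.
  have [Woo|Woo] := eqVneq (W (mdist a x)) +oo%E; last first.
    have Zx : Z x by split => //; rewrite ltey.
    apply: le_trans (pointwise Zx) _.
    by rewrite /cx indicE mem_set// mul1r.
  (* Here [W] is infinite; since the integral of [g] is finite, reverse Hoelder with [V = v] leaves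
     no finite value for [F x]. *)
  suff -> : F x = +oo%E.
    rewrite epowyr; last exact: hq.
    by apply: mule_ge0; [rewrite lee_fin; exact: cx0|exact: K0].
  apply/eqP; rewrite eq_le leey/= leNgt; apply/negP => Flty.
  have := reverse_holder (measurable_outer a (mdist a x)) mf mv f0 hv0 fv.
  rewrite Woo leye_eq -/(F x) => /eqP Hoo.
  suff : ((F x `^ p' * (\int[mu]_(y in N (mdist a x)) (g y)%:E) `^ (1 - p')) < +oo)%E.
    by rewrite Hoo.
  apply: lte_mul_pinfty; first exact: poweR_ge0.
    by apply: fin_num_poweR; rewrite ge0_fin_numE.
  by apply: poweR_lty; apply: le_lt_trans (le_gA _) _; rewrite ltry.
under eq_integral do rewrite KE.
have [mT ->] := tonelli_outer a sigma_finite_nuU sigma_finite_beta mcx mk cx0 k0.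
apply: (@le_trans _ _ (\int[beta]_y (kappa * `|p|)%:E)%E).
  apply: ge0_le_integral.
  - exact: measurableT.
  - move=> y _; apply: mule_ge0; first by rewrite lee_fin; exact: k0.
    by apply: integral_ge0 => x _; rewrite lee_fin; exact: cx0.
  - exact: mT.
  - exact: measurable_cst.
  - by move=> y _; exact: tail_le.
rewrite integral_cst; last exact: measurableT.
by rewrite [leRHS]EFinM -AE.
Qed.

End test_function.

(** The total power of [A'] is [(1 - p / q) * (q / p) + 1 = q / p], which the exponent [q^-1] turns
    into [p^-1]. *)
Let le_powR_const (b t A' : R) : 0 < b -> 0 < t -> 0 < A' ->
  (t `^ q^-1 * b `^ p'^-1 * C) * A' `^ p^-1 =
  (b `^ (q / p') * C `^ q * (A' `^ (1 - p / q)) `^ (q / p) * t * A') `^ q^-1.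
Proof.
move=> b0 t0 A0.
have [lb ->] := gt0_expR b0; have [lt ->] := gt0_expR t0.
have [lA ->] := gt0_expR A0; have [lC ->] := gt0_expR C0.
do ![rewrite powR_expR | rewrite -expRD].
by congr expR; field; apply/and3P.
Qed.

Lemma hardy_inequality_char :
  hardy_inequality mu a p q u v (`|p| `^ q^-1 * p' `^ p'^-1 * C).
Proof.
move=> f mf f0; set Ae := (\int[mu]_x (epow (f x)%:E p * (v x)%:E))%E.
have [->|Aoo] := eqVneq Ae +oo%E.
  by rewrite epowyr ?invr_lt0// mule0 epow_ge0.
pose h x := (epow (f x)%:E p * (v x)%:E)%E.
have h0 x : (0 <= h x)%E by rewrite mule_ge0 ?epow_ge0 ?lee_fin.
have mh : measurable_fun setT h.
  apply: emeasurable_funM; last exact/measurable_EFinP.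
  exact: measurable_fun_epow_EFin.
have ih : mu.-integrable setT h.
  apply/integrableP; split => //; under eq_integral do rewrite gee0_abs//.
  by rewrite ltey.
(* An integrable function is finite almost everywhere, whereas [h] is [+oo] where [f = 0 < v]. *)
have fv : {ae mu, forall x, f x = 0 -> v x = 0}.
  have := integrable_ae measurableT ih; apply: filterS => x /(_ I) + fx0.
  rewrite /h fx0 epow0r//; have [->//|v0] := eqVneq (v x) 0.
  by rewrite gt0_mulye// lte_fin lt_neqAle eq_sym v0 hv0.
pose g x := f x `^ p * v x.
have mg : measurable_fun setT g.
  by apply: measurable_funM => //; exact: measurable_fun_powR.
have gA : (\int[mu]_x (g x)%:E <= Ae)%E.
  apply: ge0_le_integral => //.
  - by move=> x _; rewrite lee_fin mulr_ge0 ?powR_ge0.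
  - exact/measurable_EFinP.
  move=> x _; rewrite epow_EFinE// EFinM lee_wpmul2r ?lee_fin//.
  by case: ifP; rewrite ?leey.
have goo : (\int[mu]_x (g x)%:E < +oo)%E by rewrite (le_lt_trans gA)// ltey.
have := integral_outer_le mf f0 fv goo.
set A := fine (\int[mu]_x (g x)%:E)%E => B_le.
have A0 : 0 <= A.
  by apply: fine_ge0; apply: integral_ge0 => x _; rewrite lee_fin mulr_ge0 ?powR_ge0.
have AE : (\int[mu]_x (g x)%:E = A%:E)%E.
  rewrite fineK// ge0_fin_numE//.
  by apply: integral_ge0 => x _; rewrite lee_fin mulr_ge0 ?powR_ge0.
have B0 : (0 <= \int[mu]_x (epow (\int[mu]_(y in N (mdist a x)) (f y)%:E) q * (u x)%:E))%E.
  by apply: integral_ge0 => x _; rewrite mule_ge0 ?epow_ge0 ?lee_fin.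
have qV : q^-1 < 0 by rewrite invr_lt0.
apply: le_trans (le_epow qV B0 B_le).
(* For [A = 0] the bound on the outer integral is 0, whose power [q^-1] is [+oo]. *)
move: A0; rewrite le_eqVlt => /orP[/eqP A0|A0].
  by rewrite -A0 mulr0 epow0r// leey.
rewrite epow_EFin; last by rewrite !mulr_gt0 ?powR_gt0// normr_gt0.
rewrite -le_powR_const ?normr_gt0// [leRHS]EFinM.
apply: lee_wpmul2l; first by rewrite lee_fin !mulr_ge0 ?powR_ge0 ?ltW.
rewrite -epow_EFin//; apply: le_epow.
- by rewrite invr_lt0.
- by rewrite lee_fin ltW.
- by rewrite -AE.
Qed.

End sufficiency.
End hardy.

(* The monotonicity of the characteristic function is a sufficient condition
   only: if u is the indicator of the unit ball of the real line and v is
   positive with v = 1 for |x| <= 2, the inequality holds although the function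
   is finite for r < 1 and +oo for r >= 1.  Hence it is not a conclusion of the
   necessity part. *)
Theorem theorem2p4 (R : realType) (d : measure_display)
    (X : borelMetricType d R) (mu : {measure set X -> \bar R}) (a : X)
    (p q p' : R) (u v : X -> R)
    (hqp : q <= p) (hp : p < 0) (hp' : p^-1 + p'^-1 = 1)
    (hpolar : polar_decomposition mu a)
    (hu0 : forall x, 0 <= u x) (hv0 : forall x, 0 <= v x)
    (hu : loc_integrable mu u) (hv : loc_integrable mu v) :
  let D2 := hardy_char_inf mu a q p' u v in
  let C2 := hardy_best_constant mu a p q u v in
  [/\ hardy_holds mu a p q u v -> (0 < D2)%E,
      (0 < D2)%E /\ hardy_char_nonincreasing mu a q p' u v ->
        hardy_holds mu a p q u v
    & hardy_holds mu a p q u v ->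
        (C2 <= D2)%E /\
        (hardy_char_nonincreasing mu a q p' u v ->
          ((`|p| `^ q^-1 * p' `^ p'^-1)%:E * D2 <= C2)%E)].
Proof.
move=> D2 C2.
have sphere0 r : (\int[mu]_(x in msphere a r) (u x)%:E = 0)%E.
  exact: integral_msphere_eq0.
have le_D2 C : 0 < C -> hardy_inequality mu a p q u v C -> (C%:E <= D2)%E.
  move=> C0 hC; apply: le_ereal_inf_tmp => _ [x /= xa <-].
  exact: (hardy_le_char hqp hp hp' hu0 hv0 hu hv C0 xa hC).
pose k := `|p| `^ q^-1 * p' `^ p'^-1.
have p'0 : 0 < p'.
  have pV : p^-1 < 0 by rewrite invr_lt0.
  by rewrite -invr_gt0; lra.
have k0 : 0 < k by rewrite mulr_gt0 ?powR_gt0// normr_gt0 lt_eqF.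
have suff_D2 C : hardy_char_nonincreasing mu a q p' u v -> 0 < C ->
    (C%:E <= D2)%E -> hardy_inequality mu a p q u v (k * C).
  move=> ni C0 CD2.
  apply: (hardy_inequality_char hqp hp hp' hu0 hv0 hu hv sphere0 ni C0).
  by move=> x xa; apply: le_trans CD2 _; apply: ereal_inf_lbound; exists x.
have sup_C2 C : hardy_char_nonincreasing mu a q p' u v -> 0 < C ->
    (C%:E <= D2)%E -> ((k * C)%:E <= C2)%E.
  move=> ni C0 CD2; apply: ereal_sup_ubound; exists (k * C) => //.
  by split; [exact: mulr_gt0|exact: suff_D2].
have pos_D2 : hardy_holds mu a p q u v -> (0 < D2)%E.
  by move=> [C C0 hC]; apply: lt_le_trans (le_D2 C C0 hC); rewrite lte_fin.
have fin_D2 : (0 < D2)%E -> D2 != +oo%E ->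
    0 < fine D2 /\ D2 = (fine D2)%:E.
  by move=> D20 Doo; rewrite -ltey in Doo; rewrite fine_gt0 ?D20// fineK// ge0_fin_numE// ltW.
split=> //.
- move=> [D20 ni]; have [Doo|Doo] := eqVneq D2 +oo%E.
    (* When [D2 = +oo] every positive [C] lies below it; 1 is an arbitrary choice. *)
    by exists (k * 1); [exact: mulr_gt0|apply: suff_D2; rewrite ?Doo ?leey].
  have [r0 DE] := fin_D2 D20 Doo.
  by exists (k * fine D2); [exact: mulr_gt0|apply: suff_D2; rewrite -?DE].
- move=> hh; have D20 := pos_D2 hh; split.
    by apply: ge_ereal_sup => _ [C [C0 hC] <-]; exact: le_D2.
  move=> ni; rewrite -/k; have [Doo|Doo] := eqVneq D2 +oo%E; last first.
    have [r0 DE] := fin_D2 D20 Doo.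
    by rewrite DE -EFinM; apply: sup_C2; rewrite -?DE.
  have {}sup_C2 C : 0 < C -> ((k * C)%:E <= C2)%E.
    by move=> C0; apply: sup_C2; rewrite ?Doo ?leey.
  suff -> : C2 = +oo%E by exact: leey.
  case: C2 sup_C2 => [r| |]// sup_C2; last by have := sup_C2 1 ltr01.
  (* A finite value [r] of [C2] would have to be at least [k] times this number, that is
     [|r| + 1]. *)
  have r0 : 0 < (`|r| + 1) / k by rewrite divr_gt0// ltr_wpDl.
  have := sup_C2 _ r0; rewrite mulrC divfK ?gt_eqF// lee_fin leNgt.
  by rewrite (le_lt_trans (ler_norm r))// ltrDl.
Qed.
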